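(* Let $h=0$, $\rho>0$ and $\varepsilon\in(-\frac{J\rho}2,0]$. Let $I\subset\Lambda$ be an index set of fixed size and $f:\mathbb{R}^{|I|}\to\mathbb{R}$ a bounded $1$-Lipschitz function with respect to $\|\cdot\|_2$. If $\varepsilon\in(-\frac{J\rho}2,0)$ and $\beta=\frac{1/J}{\rho+2\varepsilon/J}$, then \[ \langle f\circ P_I\rangle_{\mathrm{MC}}^{\varepsilon,\rho;N}=\langle f\circ P_I\rangle_{\mathrm{C}}^{\beta,\rho;N}+O(N^{-1/2}). \] If $\varepsilon=0$, then for every $\beta<\frac1{\rho J}$, \[ \langle f\circ P_I\rangle_{\mathrm{MC}}^{0,\rho;N}=\langle f\circ P_I\rangle_{\mathrm{C}}^{\beta,\rho;N}+O(N^{-1/2}). \]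
   Context: Mean-field spherical model with $h=0$: $\phi\in\mathbb{R}^N$ ($N=|\Lambda|$ sites), $J>0$, $H[\phi]=-\frac J{2N}(\sum_x\phi_x)^2$; $P_I$ restricts to sites in $I$. For $|m|<\sqrt\rho$, $\mu_{\mathrm{MC}}^{m,\rho;N}$ is the normalized uniform surface measure on $\{\sum\phi_x=mN,\ \sum\phi_x^2=\rho N\}$. For $\varepsilon\in(-\frac{\rho J}2,0)$, $\mu_{\mathrm{MC}}^{\varepsilon,\rho;N}=\frac12\mu_{\mathrm{MC}}^{\sqrt{-2\varepsilon/J},\rho;N}+\frac12\mu_{\mathrm{MC}}^{-\sqrt{-2\varepsilon/J},\rho;N}$, and $\mu_{\mathrm{MC}}^{0,\rho;N}$ is the $m=0$ ensemble. With $Z_{\mathrm{MC}}(\varepsilon,\rho;N)=(\rho+\frac{2\varepsilon}J)^{(N-3)/2}/\sqrt{-2\varepsilon/J}$, the canonical ensemble is $\langle f\rangle_{\mathrm{C}}^{\beta,\rho;N}=\frac{\int_{-\rho J/2}^0d\varepsilon'\,e^{-\beta\varepsilon'N}Z_{\mathrm{MC}}(\varepsilon',\rho;N)\langle f\rangle_{\mathrm{MC}}^{\varepsilon',\rho;N}}{\int_{-\rho J/2}^0d\varepsilon'\,e^{-\beta\varepsilon'N}Z_{\mathrm{MC}}(\varepsilon',\rho;N)}$, $\beta\in\mathbb{R}$. *)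

(* Defs.v *)
From HB Require Import structures.
From mathcomp Require Import all_boot all_order all_algebra.
From mathcomp Require Import all_classical all_reals all_analysis.
Set Implicit Arguments. Unset Strict Implicit. Unset Printing Implicit Defensive.
Import Order.TTheory GRing.Theory Num.Theory.
Local Open Scope ring_scope.

Section Defs.
Variable R : realType.

Definition norm2 (n : nat) (x : n.-tuple R) : R :=
  Num.sqrt (\sum_(i < n) tnth x i ^+ 2).

(* n-fold iterated Lebesgue integral over R^n of an extended-real function
   (for non-negative measurable integrands this is the integral w.r.t. the
   n-dimensional Lebesgue measure, by Tonelli). *)
Fixpoint iint (n : nat) : (n.-tuple R -> \bar R) -> \bar R :=
  match n as n0 return (n0.-tuple R -> \bar R) -> \bar R with
  | 0 => fun F => F [tuple]
  | n'.+1 => fun F =>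
      (\int[@lebesgue_measure R]_(x in [set: R])
         iint (fun t : n'.-tuple R => F [tuple of x :: t]))%E
  end.

(* Lebesgue integral over R^n of a real function (positive part minus
   negative part); used only for bounded integrands of bounded support. *)
Definition lint (n : nat) (F : n.-tuple R -> R) : R :=
  fine (iint (fun t => (Num.max (F t) 0)%:E))
  - fine (iint (fun t => (Num.max (- F t) 0)%:E)).

(* Linear parametrisation of the hyperplane {sum_x y_x = 0} of R^(n+1)
   by its last n coordinates. *)
Definition hyp (n : nat) (y : n.-tuple R) : n.+1.-tuple R :=
  [tuple of (- \sum_(i < n) tnth y i) :: y].

(* Expectation of G : R^(n+1) -> R under the normalised uniform surface
   measure on the (n-1)-sphere
     { phi in R^N : sum_x phi_x = m N, sum_x phi_x^2 = rho N },  N = n+1,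
   i.e. the sphere of radius r = sqrt(N (rho - m^2)) centred at m(1,...,1)
   inside the affine hyperplane sum_x phi_x = m N.  The normalised surface
   measure is realised as the normalised cone measure: the direction y/|y|
   of a point y distributed according to (normalised) Lebesgue measure on
   the unit ball of the hyperplane {sum = 0}. *)
Definition mc_sphere_expect (n : nat) (m rho : R)
    (G : n.+1.-tuple R -> R) : R :=
  let r := Num.sqrt (n.+1%:R * (rho - m ^+ 2)) in
  let inB y := norm2 (hyp y) <= 1 in
  let pt y := [tuple m + r * (tnth (hyp y) i / norm2 (hyp y)) | i < n.+1] in
  lint (fun y => if inB y then G (pt y) else 0)
  / lint (fun y => if inB y then 1 else 0).

Definition mc_expect (n : nat) (J eps rho : R) (G : n.+1.-tuple R -> R) : R :=
  if eps < 0 then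
    let m := Num.sqrt (- (2 * eps) / J) in
    (mc_sphere_expect m rho G + mc_sphere_expect (- m) rho G) / 2
  else mc_sphere_expect 0 rho G.

Definition Z_MC (n : nat) (J eps rho : R) : R :=
  powR (rho + 2 * eps / J) ((n.+1%:R - 3) / 2) / Num.sqrt (- (2 * eps) / J).

Definition c_expect (n : nat) (J beta rho : R) (G : n.+1.-tuple R -> R) : R :=
  let w e := expR (- beta * e * n.+1%:R) * Z_MC n J e rho in
  Rintegral (@lebesgue_measure R) `[- (rho * J) / 2, 0]%classic
            (fun e => w e * mc_expect J e rho G)
  / Rintegral (@lebesgue_measure R) `[- (rho * J) / 2, 0]%classic w.

(* Restriction P_I of a configuration to the sites of I, where the index
   set I subset Lambda of size k is given by an injective enumeration. *)
Definition proj_sites (n k : nat) (I : 'I_k -> 'I_n) (phi : n.-tuple R)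
  : k.-tuple R := [tuple tnth phi (I i) | i < k].

End Defs.

(* Main.v *)
(** A Lipschitz bound reduces both claims to a concentration estimate.  Writing
a point of the sphere as [m + r u] with [u] uniform on the unit sphere of the
hyperplane [sum = 0], exchangeability gives [E u_i^2 <= 1/N]; since [r] is
[sqrt N * sqrt (rho - m^2)], the microcanonical mean of [f] is Lipschitz in
[(m, sqrt (rho - m^2))] with a constant independent of [N].

For the canonical weight put [v = m^2 = - 2 e / J] and [u = rho - v], so that
the weight is [exp (- beta e N) u^((N-3)/2) / sqrt v].  Integrating the
derivative of [exp (- beta e N) u^((N-1)/2) sqrt v * h v] over the energy range
gives a vanishing weighted integral of an explicit function of [v].  For a
suitable [h] that function is at most [C - A N chi v] with [chi v >= 0]
vanishing only at the peak of the weight, hence the weighted mean of [chi] is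
[O(1/N)].  For [eps < 0] the peak is [v0 = - 2 eps / J] and
[h v = - (v - v0) / (v + kappa / N)] yields [chi v = (v - v0)^2]: the shift
[kappa / N] keeps [h] smooth while controlling the singularity of the weight at
[v = 0].  For [eps = 0] the peak is [v = 0] and [h = -1] yields [chi v = v]. *)
Require Import Defs.
From HB Require Import structures.
From mathcomp Require Import all_boot all_order all_algebra.
From mathcomp Require Import all_classical all_reals all_analysis.
From mathcomp Require Import perm measurable_realfun ring lra.
Import Order.TTheory GRing.Theory Num.Theory.
Import numFieldNormedType.Exports.
Local Open Scope classical_set_scope.
Local Open Scope ring_scope.

Set Implicit Arguments.
Unset Strict Implicit.
Unset Printing Implicit Defensive.

(** * Iterated Lebesgue integrals *)

(** The push-forward of Lebesgue measure under [x |-> c - x] gives half-open intervals their length,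
    so it is Lebesgue measure by uniqueness. *)
Lemma ge0_integral_reflect (R : realType) (F : R -> \bar R) (c : R) :
  measurable_fun setT F -> (forall x, (0 <= F x)%E) ->
  (\int[@lebesgue_measure R]_x F (c - x)%R = \int[@lebesgue_measure R]_x F x)%E.
Proof.
move=> mF F0; pose phi : measurableTypeR R -> measurableTypeR R := fun x => c - x.
have mphi : measurable_fun setT phi by exact: measurable_funB.
have -> : (\int[@lebesgue_measure R]_x F x =
    \int[pushforward (@lebesgue_measure R) phi]_x F x)%E.
  apply: eq_measure_integral => A mA _.
  apply: lebesgue_measure_unique => // _ [[a b]] _ <-.
  transitivity (@lebesgue_measure R `[c - b, c - a[%classic); last first.
    congr (lebesgue_measure _); apply/seteqP; split => x /=; rewrite /phi !in_itv/= => /andP[? ?];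
    apply/andP; split; lra.
  rewrite !lebesgue_measure_itv/= !lte_fin ltrD2l ltrN2.
  by case: ifP => // _; rewrite -!EFinB; congr EFin; ring.
by rewrite ge0_integral_pushforward.
Qed.

Section iterated_integral.
Context {R : realType}.
Local Notation mu := (@lebesgue_measure R).
Local Notation RT := (measurableTypeR R).
Local Open Scope ereal_scope.

Lemma iint_ge0 n (F : n.-tuple R -> \bar R) :
  (forall t, 0 <= F t) -> 0 <= iint F.
Proof.
elim: n F => [|n IH] F F0 /=; first exact: F0.
by apply: integral_ge0 => x _; apply: IH => t; exact: F0.
Qed.

(** The parameter space [T] carries the induction: the head coordinate is absorbed into the
    parameter [T * RT], and one Tonelli step then integrates it out. *)
Lemma measurable_iint d (T : measurableType d) n
    (F : T * n.-tuple RT -> \bar R) :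
  measurable_fun setT F -> (forall p, 0 <= F p) ->
  measurable_fun setT (fun x => iint (fun t => F (x, t))).
Proof.
elim: n d T F => [|n IH] d T F mF F0 /=.
  by apply: measurableT_comp => //; exact: measurable_fun_pair.
pose G (q : (T * RT) * n.-tuple RT) := F (q.1.1, [tuple of q.1.2 :: q.2]).
have mG : measurable_fun setT G.
  apply: measurableT_comp => //; apply: measurable_fun_pair.
    by apply: measurableT_comp => //; exact: measurable_fst.
  by apply: measurable_cons => //; apply: measurableT_comp.
apply: (@measurable_fun_fubini_tonelli_F _ _ T RT R mu
  (fun p => iint (fun t => G (p, t)))); last by move=> p; apply: iint_ge0 => t; exact: F0.
by apply: IH => // p; exact: F0.
Qed.

Lemma measurable_cons_section n (F : n.+1.-tuple RT -> \bar R) :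
  measurable_fun setT F ->
  measurable_fun setT (fun p : RT * n.-tuple RT => F [tuple of p.1 :: p.2]).
Proof. by move=> mF; apply: measurableT_comp => //; exact: measurable_cons. Qed.

Lemma measurable_iint_cons n (F : n.+1.-tuple RT -> \bar R) :
  measurable_fun setT F -> (forall p, 0 <= F p) ->
  measurable_fun setT (fun x : RT => iint (fun t => F [tuple of x :: t])).
Proof.
move=> mF F0; apply: (@measurable_iint _ _ n (fun p : RT * n.-tuple RT => F [tuple of p.1 ::
  p.2])) => //.
exact: measurable_cons_section.
Qed.

Lemma measurable_fun_cons n (F : n.+1.-tuple RT -> \bar R) x :
  measurable_fun setT F ->
  measurable_fun setT (fun t : n.-tuple RT => F [tuple of x :: t]).
Proof. by move=> mF; apply: measurableT_comp => //; exact: measurable_cons. Qed.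

Lemma le_iint n (F G : n.-tuple RT -> \bar R) :
  measurable_fun setT F -> measurable_fun setT G ->
  (forall t, 0 <= F t) -> (forall t, F t <= G t) -> iint F <= iint G.
Proof.
elim: n F G => [|n IH] F G mF mG F0 FG /=; first exact: FG.
have G0 t : 0 <= G t by exact: le_trans (FG t).
apply: ge0_le_integral => //.
- by move=> x _; exact: iint_ge0.
- exact: measurable_iint_cons.
- exact: measurable_iint_cons.
- by move=> x _; apply: IH => //; exact: measurable_fun_cons.
Qed.

Lemma iintD n (F G : n.-tuple RT -> \bar R) :
  measurable_fun setT F -> measurable_fun setT G ->
  (forall t, 0 <= F t) -> (forall t, 0 <= G t) ->
  iint (fun t => F t + G t) = iint F + iint G.
Proof.
elim: n F G => [//|n IH] F G mF mG F0 G0 /=.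
rewrite -ge0_integralD//; last 4 first.
- by move=> x _; exact: iint_ge0.
- exact: measurable_iint_cons.
- by move=> x _; exact: iint_ge0.
- exact: measurable_iint_cons.
by apply: eq_integral => x _; rewrite IH//; exact: measurable_fun_cons.
Qed.

Lemma iintZl n (k : R) (F : n.-tuple RT -> \bar R) :
  measurable_fun setT F -> (forall t, 0 <= F t) -> (0 <= k)%R ->
  iint (fun t => k%:E * F t) = k%:E * iint F.
Proof.
elim: n F => [//|n IH] F mF F0 k0 /=.
rewrite -ge0_integralZl//; last 2 first.
- exact: measurable_iint_cons.
- by move=> x _; exact: iint_ge0.
by apply: eq_integral => x _; rewrite IH//; exact: measurable_fun_cons.
Qed.

(** Tonelli, one coordinate at a time: [x] is swapped with the head coordinate, then the induction
    hypothesis moves it past the tail. *)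
Lemma iint_exchange n (F : RT * n.-tuple RT -> \bar R) :
  measurable_fun setT F -> (forall p, 0 <= F p) ->
  \int[mu]_x iint (fun t => F (x, t)) = iint (fun t => \int[mu]_x F (x, t)).
Proof.
elim: n F => [//|n IH] F mF F0 /=.
pose G (q : (RT * RT) * n.-tuple RT) := F (q.1.1, [tuple of q.1.2 :: q.2]).
have mG : measurable_fun setT G.
  apply: measurableT_comp => //; apply: measurable_fun_pair.
    by apply: measurableT_comp => //; exact: measurable_fst.
  by apply: measurable_cons => //; apply: measurableT_comp.
rewrite (@fubini_tonelli _ _ _ _ _ mu mu (fun p => iint (fun t => G (p, t))))//; last 2 first.
- by apply: measurable_iint => // p; exact: F0.
- by move=> p; apply: iint_ge0 => t; exact: F0.
apply: eq_integral => y _.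
rewrite -(IH (fun p => F (p.1, [tuple of y :: p.2])))//.
apply: measurableT_comp => //; apply: measurable_fun_pair => //.
exact: measurable_cons.
Qed.

(** For [c = 0] this is, in the chart [hyp], the exchange of the dependent coordinate with
    coordinate [i]. A general [c] serves the induction, since freezing a head coordinate [x]
    replaces [c] by [c - x]. *)
Definition reflect_coord n (i : 'I_n) (c : R) (y : n.-tuple R) : n.-tuple R :=
  [tuple if j == i then c - \sum_(l < n) tnth y l else tnth y j | j < n]%R.

(* The coordinate substitution y_i |-> c - sum y has Jacobian -1. *)
Lemma iint_reflect_coord n (i : 'I_n) (c : R) (F : n.-tuple RT -> \bar R) :
  measurable_fun setT F -> (forall p, 0 <= F p) ->
  iint (F \o reflect_coord i c) = iint F.
Proof.
elim: n i c F => [[]//|n IH] i c F mF F0 /=.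
have [i' ->|->] := unliftP ord0 i.
  apply: eq_integral => x _; rewrite -(IH i' (c - x)%R (fun t => F [tuple of x :: t]))//;
    last exact: measurable_fun_cons.
  congr iint; apply/funext => t /=; congr F; apply: eq_from_tnth => j.
  rewrite tnth_mktuple big_ord_recl tnth0.
  have [j' ->|->] := unliftP ord0 j; last by rewrite !tnth0 (negbTE (neq_lift _ _)).
  rewrite (inj_eq lift_inj) !tnthS tnth_mktuple.
  by case: eqP => // _; rewrite opprD addrA; under eq_bigr do rewrite tnthS.
(* When [i] is the head, its integral is moved inside the others, where the substitution is the
   reflection [x |-> (c - sum t) - x] of a single real variable. *)
pose G (p : RT * n.-tuple RT) := F [tuple of p.1 :: p.2].
have mG : measurable_fun setT G by exact: measurable_cons_section.
have G0 p : 0 <= G p by exact: F0.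
transitivity (\int[mu]_x iint (fun t : n.-tuple RT => G (c - \sum_(l < n) tnth t l - x, t)%R)).
  apply: eq_integral => x _; congr iint; apply/funext => t; congr F.
  apply: eq_from_tnth => j.
  rewrite tnth_mktuple big_ord_recl tnth0.
  have [j' ->|->] := unliftP ord0 j; last first.
    rewrite eqxx tnth0 /=; under eq_bigr do rewrite tnthS; ring.
  by rewrite eq_sym (negbTE (neq_lift _ _)) !tnthS.
rewrite (iint_exchange (F := fun p : RT * n.-tuple RT => G (c - \sum_(l < n) tnth p.2 l - p.1,
  p.2)%R))//; last first.
  apply: (measurableT_comp mG); apply: measurable_fun_pair => //.
  apply: measurable_funB => //; apply: measurable_funB => //.
  apply: measurable_sum => l; apply: (measurableT_comp (measurable_tnth _)) => //.
rewrite (iint_exchange (F := G))//; congr iint; apply/funext => t /=.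
rewrite (ge0_integral_reflect (F := fun x => G (x, t)))//.
by apply: measurableT_comp => //; exact: measurable_fun_pair.
Qed.

End iterated_integral.

(** * Measurability of Lipschitz observables *)

Section lipschitz_measurable.
Context {R : realType}.
Local Notation RT := (measurableTypeR R).

Lemma measurable_norm2 d (T : measurableType d) n (g : T -> n.-tuple RT) :
  measurable_fun setT g -> measurable_fun setT (fun x => norm2 (g x)).
Proof.
move=> mg; apply: (measurableT_comp (continuous_measurable_fun (@sqrt_continuous R))).
apply: measurable_sum => i; apply: measurable_funX.
exact: (measurableT_comp (measurable_tnth i)).
Qed.

Lemma norm2_small n (x : n.-tuple R) (e : R) : 0 < e ->
  (forall i, `|tnth x i| < e / n.+1%:R) -> norm2 x <= e.
Proof.
move=> e0 xe; rewrite /norm2 -(ger0_norm (ltW e0)) -sqrtr_sqr ler_sqrt ?sqr_ge0//.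
apply: (@le_trans _ _ (\sum_(i < n) (e / n.+1%:R) ^+ 2)).
  apply: ler_sum => i _; rewrite -real_normK ?num_real//.
  by rewrite lerXn2r ?nnegrE// ?divr_ge0// ?ltW.
rewrite sumr_const card_ord -[leLHS]mulr_natr expr_div_n mulrAC.
rewrite ler_pdivrMr ?exprn_gt0// ler_wpM2l ?sqr_ge0// -natrX ler_nat.
by rewrite (leq_trans (leqnSn n))// leq_pmulr.
Qed.

(** The sublevel set [f < c] is the countable union of the balls of radius [c - f q] about rational
    points [q]; the Lipschitz bound puts each ball inside the set. *)
Lemma lipschitz_norm2_measurable k (f : k.-tuple R -> R) :
  (forall x y : k.-tuple R,
     `|f x - f y| <= norm2 [tuple tnth x i - tnth y i | i < k]) ->
  measurable_fun setT (f : k.-tuple RT -> R).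
Proof.
move=> lf; apply: (measurability _ (RGenInftyO.measurableE R)).
move=> _ [_ [c ->] <-].
pose Q (q : k.-tuple rat) : k.-tuple R := [tuple ratr (tnth q i) | i < k].
pose d (q : k.-tuple rat) (x : k.-tuple RT) : k.-tuple RT :=
  [tuple tnth x i - tnth (Q q) i | i < k].
rewrite [X in measurable X](_ : _ =
  \bigcup_(q in [set: k.-tuple rat]) [set x | norm2 (d q x) < c - f (Q q)]); last first.
  apply/seteqP; split => [x [_ /=]|x [q _ /=]]; rewrite in_itv/=; last first.
    move=> h; split => //=.
    have := lf x (Q q); rewrite ler_norml -/(d q x) => /andP[_ +]; lra.
  (* A rational point [q] within [e] of [x] has [c - f q >= 2 * e > e], so a third of the gap leaves
     the strict inequality that puts [x] in the open ball about [q]. *)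
  move=> fxc; pose e := (c - f x) / 3.
  have e0 : 0 < e by rewrite /e; lra.
  have h i : exists r : rat, `|tnth x i - ratr r| < e / k.+1%:R.
    have : 0 < e / k.+1%:R by rewrite divr_gt0.
    move: (e / k.+1%:R) => z z0.
    have xz : tnth x i - z < tnth x i + z by lra.
    have [r] := rat_in_itvoo xz; rewrite in_itv/= => /andP[? ?].
    by exists r; rewrite ltr_norml; apply/andP; split; lra.
  have [q hq] := choice h.
  exists [tuple q i | i < k] => //=.
  have dq : norm2 (d [tuple q i | i < k] x) <= e.
    by apply: norm2_small => // i; rewrite !tnth_mktuple.
  have := lf x (Q [tuple q i | i < k]); rewrite -/(d _ x) ler_norml => /andP[].
  rewrite /e in dq *; lra.
apply: countable_bigcupT_measurable => // q.
rewrite -[X in measurable X]setTI.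
have := @measurable_fun_ltr _ _ _ setT (fun x => norm2 (d q x)) (fun=> c - f (Q q)).
move=> /(_ _ _ measurableT [set true]); rewrite setTI; apply => //.
apply: measurable_norm2; apply/measurable_fun_tnthP => i.
rewrite (_ : _ \o _ = fun x => tnth x i - tnth (Q q) i); last first.
  by apply/funext => x /=; rewrite tnth_mktuple.
by apply: measurable_funB => //; exact: measurable_tnth.
Qed.

End lipschitz_measurable.

(** * Comparison of finite integrals over tuples *)

Section lint.
Context {R : realType}.
Local Notation RT := (measurableTypeR R).

Lemma iint0 n : iint (fun _ : n.-tuple R => 0%E) = 0%E.
Proof.
by elim: n => //= n ->; rewrite integral0.
Qed.

Lemma iint_sum n (I : Type) (s : seq I) (F : I -> n.-tuple RT -> \bar R) :
  (forall i, measurable_fun setT (F i)) -> (forall i t, 0 <= F i t)%E ->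
  iint (fun t => \sum_(i <- s) F i t)%E = (\sum_(i <- s) iint (F i))%E.
Proof.
move=> mF F0; elim: s => [|i s IH].
  rewrite big_nil -[RHS](iint0 n); congr iint; apply/funext => t.
  by rewrite big_nil.
rewrite big_cons -IH -iintD//; first by congr iint; apply/funext => t; rewrite big_cons.
  exact: emeasurable_sum.
by move=> t; apply: sume_ge0.
Qed.

Lemma fine_iint_le n (F G : n.-tuple RT -> R) :
  measurable_fun setT F -> measurable_fun setT G ->
  (forall t, 0 <= F t <= G t) -> (iint (fun t => (G t)%:E) < +oo)%E ->
  (iint (fun t => (F t)%:E) < +oo)%E /\
  fine (iint (fun t => (F t)%:E)) <= fine (iint (fun t => (G t)%:E)).
Proof.
move=> mF mG FG Goo.
have FGle : (iint (fun t => (F t)%:E) <= iint (fun t => (G t)%:E))%E.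
  by apply: le_iint => [| |t|t]; try exact/measurable_EFinP; rewrite lee_fin; case/andP: (FG t).
have Foo := le_lt_trans FGle Goo.
have F0 : (0 <= iint (fun t => (F t)%:E))%E.
  by apply: iint_ge0 => t; rewrite lee_fin; case/andP: (FG t).
have G0 := le_trans F0 FGle.
by split => //; rewrite fine_le// ge0_fin_numE.
Qed.

Lemma fine_iintD n (F G : n.-tuple RT -> R) :
  measurable_fun setT F -> measurable_fun setT G ->
  (forall t, 0 <= F t) -> (forall t, 0 <= G t) ->
  (iint (fun t => (F t)%:E) < +oo)%E -> (iint (fun t => (G t)%:E) < +oo)%E ->
  (iint (fun t => (F t + G t)%:E) < +oo)%E /\
  fine (iint (fun t => (F t + G t)%:E)) =
  fine (iint (fun t => (F t)%:E)) + fine (iint (fun t => (G t)%:E)).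
Proof.
move=> mF mG F0 G0 Foo Goo.
under eq_fun do rewrite EFinD.
rewrite iintD; try by [move=> t; rewrite lee_fin | exact/measurable_EFinP].
split; first by rewrite lte_add_pinfty.
by rewrite fineD// ge0_fin_numE//; apply: iint_ge0 => t; rewrite lee_fin.
Qed.

(** Positive and negative parts each move by at most the integral of [D], hence the factor 2. The
    common majorant [B] makes the integrals of these parts finite, so that [fine] loses nothing. *)
Lemma lint_dist_le n (F1 F2 B D : n.-tuple RT -> R) :
  measurable_fun setT F1 -> measurable_fun setT F2 ->
  measurable_fun setT B -> measurable_fun setT D ->
  (forall t, `|F1 t| <= B t) -> (forall t, `|F2 t| <= B t) ->
  (forall t, `|F1 t - F2 t| <= D t) ->
  (iint (fun t => (B t)%:E) < +oo)%E -> (iint (fun t => (D t)%:E) < +oo)%E ->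
  `|lint F1 - lint F2| <= 2 * fine (iint (fun t => (D t)%:E)).
Proof.
move=> mF1 mF2 mB mD F1B F2B F12 Boo Doo.
have D0 t : 0 <= D t by rewrite (le_trans _ (F12 t)).
have part_le (G G' : n.-tuple RT -> R) : measurable_fun setT G -> measurable_fun setT G' ->
    (forall t, `|G t| <= B t) -> (forall t, `|G' t| <= B t) ->
    (forall t, G t <= G' t + D t) ->
    fine (iint (fun t => (Num.max (G t) 0)%:E)) <=
    fine (iint (fun t => (Num.max (G' t) 0)%:E)) + fine (iint (fun t => (D t)%:E)).
  move=> mG mG' GB G'B GG'.
  have mp (H : n.-tuple RT -> R) : measurable_fun setT H ->
      measurable_fun setT (fun t => Num.max (H t) 0).
    by move=> mH; apply: (@measurable_maxr _ _ _ setT H (fun=> 0)).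
  have [G'oo _] : (iint (fun t => (Num.max (G' t) 0)%:E) < +oo)%E /\
      fine (iint (fun t => (Num.max (G' t) 0)%:E)) <= fine (iint (fun t => (B t)%:E)).
    apply: fine_iint_le => //; first exact: mp.
    move=> t; rewrite le_max lexx orbT/= ge_max.
    by have := G'B t; rewrite ler_norml => /andP[]; have := normr_ge0 (G' t); have := G'B t; lra.
  have [oo <-] := fine_iintD (mp _ mG') mD (fun t => ltac:(by rewrite le_max lexx orbT)) D0 G'oo
    Doo.
  apply: (fine_iint_le _ _ _ oo).2; [exact: mp|exact: measurable_funD (mp _ mG') mD|].
  move=> t; rewrite le_max lexx orbT/= ge_max.
  have : G' t <= Num.max (G' t) 0 by rewrite le_max lexx.
  have : 0 <= Num.max (G' t) 0 by rewrite le_max lexx orbT.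
  by have := GG' t; have := D0 t => ? ? ? ?; apply/andP; split; lra.
have h t : F1 t <= F2 t + D t /\ F2 t <= F1 t + D t.
  by have := F12 t; rewrite ler_norml => /andP[? ?]; split; lra.
have nb (G : n.-tuple RT -> R) : (forall t, `|G t| <= B t) -> forall t, `|- G t| <= B t.
  by move=> GB t; rewrite normrN.
have a1 := part_le _ _ mF1 mF2 F1B F2B (fun t => (h t).1).
have a2 := part_le _ _ mF2 mF1 F2B F1B (fun t => (h t).2).
have mN1 : measurable_fun setT (fun t => - F1 t) by exact: measurable_funN.
have mN2 : measurable_fun setT (fun t => - F2 t) by exact: measurable_funN.
have a3 := part_le _ _ mN1 mN2 (nb _ F1B) (nb _ F2B) (fun t => ltac:(by have := (h t).2; lra)).
have a4 := part_le _ _ mN2 mN1 (nb _ F2B) (nb _ F1B) (fun t => ltac:(by have := (h t).1; lra)).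
rewrite /lint ler_norml; apply/andP; split; lra.
Qed.

End lint.

(** * Lipschitz dependence of the microcanonical mean *)

Section sphere.
Context {R : realType}.
Local Notation RT := (measurableTypeR R).

(** At the origin division by zero makes this the zero vector, so its squared length is at most 1
    rather than exactly 1. *)
Definition direction n (y : n.-tuple R) (j : 'I_n.+1) : R :=
  tnth (hyp y) j / norm2 (hyp y).

Definition ball_indic n (y : n.-tuple R) : R := if norm2 (hyp y) <= 1 then 1 else 0.

Lemma norm2_ge0 n (x : n.-tuple R) : 0 <= norm2 x.
Proof. exact: sqrtr_ge0. Qed.

Lemma sqr_norm2 n (x : n.-tuple R) : norm2 x ^+ 2 = \sum_(i < n) tnth x i ^+ 2.
Proof. by rewrite sqr_sqrtr// sumr_ge0// => i _; exact: sqr_ge0. Qed.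

Lemma ball_indic_ge0 n (y : n.-tuple R) : 0 <= ball_indic y.
Proof. by rewrite /ball_indic; case: ifP. Qed.

Lemma measurable_hyp n : measurable_fun setT (@hyp R n : n.-tuple RT -> n.+1.-tuple RT).
Proof.
apply: measurable_cons => //; apply: measurable_funN; apply: measurable_sum => i.
exact: measurable_tnth.
Qed.

Lemma measurable_ball_indic n : measurable_fun setT (@ball_indic n : n.-tuple RT -> R).
Proof.
apply: measurable_fun_ifT => //; apply: measurable_fun_ler => //.
exact: (measurable_norm2 (@measurable_hyp n)).
Qed.

Lemma measurable_direction n j : measurable_fun setT (fun y : n.-tuple RT => direction y j).
Proof.
rewrite (_ : (fun _ => _) = fun y : n.-tuple RT => tnth (hyp y) j * powR (norm2 (hyp y)) (-1)).
  apply: measurable_funM.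
    exact: (measurableT_comp (measurable_tnth j) (@measurable_hyp n)).
  exact: (measurableT_comp (measurable_powR _) (measurable_norm2 (@measurable_hyp n))).
by apply/funext => y; rewrite /direction powR_inv1// norm2_ge0.
Qed.

Lemma sum_sqr_direction_le1 n (y : n.-tuple R) : \sum_j direction y j ^+ 2 <= 1.
Proof.
under eq_bigr do rewrite expr_div_n.
rewrite -mulr_suml -sqr_norm2; have [->|h] := eqVneq (norm2 (hyp y)) 0.
  by rewrite expr0n mul0r.
by rewrite divff// expf_neq0.
Qed.

(** Replacing [y_i] by [- sum y] turns the dependent coordinate into [y_i]. Transpositions of sites
    thus become volume-preserving substitutions of the chart. *)
Lemma hyp_reflect n (i : 'I_n) (y : n.-tuple R) j :
  tnth (hyp (reflect_coord i 0 y)) j = tnth (hyp y) (tperm ord0 (lift ord0 i) j).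
Proof.
have [j' ->|->] := unliftP ord0 j; rewrite ?tnthS ?tnth0.
  rewrite tnth_mktuple; case: eqP => [->|/eqP j'i].
    by rewrite tpermR tnth0 sub0r.
  rewrite tpermD ?tnthS ?neq_lift//.
  by rewrite (inj_eq lift_inj) eq_sym.
rewrite tpermL tnthS (bigD1 i)//= tnth_mktuple eqxx.
rewrite [X in _ + X](eq_bigr (fun j => tnth y j)); last first.
  by move=> l li; rewrite tnth_mktuple (negbTE li).
rewrite [X in (0 - X)](bigD1 i)//=; ring.
Qed.

Lemma norm2_hyp_reflect n (i : 'I_n) (y : n.-tuple R) :
  norm2 (hyp (reflect_coord i 0 y)) = norm2 (hyp y).
Proof.
rewrite /norm2 [in RHS](reindex_inj (@perm_inj _ (tperm ord0 (lift ord0 i))))/=.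
by congr Num.sqrt; apply: eq_bigr => j _; rewrite hyp_reflect.
Qed.

(** Unnormalised: dividing by the volume of the ball in the chart gives [E u_j^2] for a uniform
    direction [u]. *)
Definition second_moment n (j : 'I_n.+1) : \bar R :=
  iint (fun y : n.-tuple R => (ball_indic y * direction y j ^+ 2)%:E).

Lemma measurable_second_moment n (j : 'I_n.+1) :
  measurable_fun setT (fun y : n.-tuple RT => (ball_indic y * direction y j ^+ 2)).
Proof.
apply: measurable_funM; first exact: measurable_ball_indic.
by apply: measurable_funX; exact: measurable_direction.
Qed.

Lemma second_moment_ge0 n (j : 'I_n.+1) (y : n.-tuple R) :
  0 <= ball_indic y * direction y j ^+ 2.
Proof. by rewrite mulr_ge0 ?ball_indic_ge0 ?sqr_ge0. Qed.

Lemma second_moment_eq n (j : 'I_n.+1) : second_moment j = second_moment (ord0 : 'I_n.+1).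
Proof.
have [i ->|->//] := unliftP ord0 j.
rewrite /second_moment -(iint_reflect_coord i 0 (F := fun y => (ball_indic y * direction y ord0
  ^+ 2)%:E))//.
- congr iint; apply/funext => y; congr EFin.
  by rewrite /ball_indic /direction /= norm2_hyp_reflect hyp_reflect tpermL.
- apply/measurable_EFinP. exact: (measurable_second_moment ord0).
- by move=> y; rewrite lee_fin second_moment_ge0.
Qed.

Lemma iint_sum_ord n p (F : 'I_p -> n.-tuple RT -> R) :
  (forall i, measurable_fun setT (F i)) -> (forall i t, 0 <= F i t) ->
  iint (fun t => (\sum_(i < p) F i t)%:E) = (\sum_(i < p) iint (fun t => (F i t)%:E))%E.
Proof.
move=> mF F0; rewrite -iint_sum => [|i|i t].
- by congr iint; apply/funext => t; rewrite sumEFin.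
- exact/measurable_EFinP.
- by rewrite lee_fin.
Qed.

(** By exchangeability the [n.+1] second moments coincide, and the squares of the direction sum to
    at most 1: this is [E u_j^2 <= 1 / N]. *)
Lemma second_moment_le n (j : 'I_n.+1) :
  (n.+1%:R%:E * second_moment j <= iint (fun y : n.-tuple R => (ball_indic y)%:E))%E.
Proof.
have -> : (n.+1%:R%:E * second_moment j = \sum_(i < n.+1) second_moment i)%E.
  rewrite (eq_bigr (fun=> second_moment j)); last first.
    by move=> i _; rewrite (second_moment_eq i) (second_moment_eq j).
  by rewrite big_const_ord iter_addr addr0 mule_natl.
rewrite -iint_sum_ord; last 2 first.
- by move=> i; exact: measurable_second_moment.
- by move=> i t; exact: second_moment_ge0.
apply: le_iint.
- apply/measurable_EFinP/measurable_sum => i; exact: measurable_second_moment.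
- by apply/measurable_EFinP; exact: (@measurable_ball_indic n).
- by move=> t; rewrite lee_fin sumr_ge0// => i _; exact: second_moment_ge0.
- move=> t; rewrite lee_fin -mulr_sumr ler_piMr ?ball_indic_ge0//.
  exact: sum_sqr_direction_le1.
Qed.

Lemma lint_ball_indic n : lint (@ball_indic n) = fine (iint (fun y : n.-tuple R => (ball_indic
  y)%:E)).
Proof.
rewrite /lint; under eq_fun do rewrite max_l ?ball_indic_ge0//.
rewrite [X in _ - fine X](_ : _ = 0%E) ?subr0// -[RHS](iint0 n).
by congr iint; apply/funext => t; rewrite max_r// oppr_le0 ball_indic_ge0.
Qed.

(** The two spheres are coupled by the same direction [u]: corresponding sites differ by
    [(m - m') + sqrt N * (s - s') * u_i], with [s = sqrt (rho - m^2)] and [s'] likewise, and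
    [N * E u_i^2 <= 1] removes the dependence on [N]. *)
Lemma mc_sphere_lipschitz k (f : k.-tuple R -> R) (M : R) n (I : 'I_k -> 'I_n.+1)
    (m m' rho : R) :
  (forall x, `|f x| <= M) ->
  (forall x y : k.-tuple R,
      `|f x - f y| <= norm2 [tuple tnth x i - tnth y i | i < k]) ->
  `| mc_sphere_expect m rho (fun phi => f (proj_sites I phi))
     - mc_sphere_expect m' rho (fun phi => f (proj_sites I phi)) | <=
  2 * (1 + 4 * k%:R) *
   (`|m - m'| + `|Num.sqrt (rho - m ^+ 2) - Num.sqrt (rho - m' ^+ 2)|).
Proof.
move=> fM flip; set del := `|m - m'| + _.
have del0 : 0 <= del by rewrite addr_ge0.
rewrite /mc_sphere_expect -/(@ball_indic n) lint_ball_indic -mulrBl normrM normfV.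
set V := iint _.
have V0 : (0 <= V)%E by apply: iint_ge0 => t; rewrite lee_fin ball_indic_ge0.
have K0 : 0 <= 2 * (1 + 4 * k%:R) * del :> R.
  by rewrite mulr_ge0// mulr_ge0// addr_ge0// mulr_ge0.
(* If [V] is 0 or infinite then [fine V = 0], and both quotients are 0 by the convention on division
   by zero. *)
have [v0|v0] := eqVneq (fine V) 0; first by rewrite v0 normr0 invr0 mulr0.
have Voo : (V < +oo)%E by move: v0 V0; case: (V) => //= [r|]; rewrite ?ltry// eqxx.
have vp : 0 < fine V by rewrite lt_neqAle eq_sym v0 fine_ge0.
rewrite (gtr0_norm vp) ler_pdivrMr//.
pose pt (m : R) (y : n.-tuple R) := [tuple m + Num.sqrt (n.+1%:R * (rho - m ^+ 2)) * direction y
  i | i < n.+1].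
pose F m (y : n.-tuple RT) : R := if norm2 (hyp y) <= 1 then f (proj_sites I (pt m y)) else 0.
rewrite -/(F m) -/(F m').
(* Pointwise majorant of the difference, affine in the squares [u_i^2] so that its integral needs
   only second moments. *)
pose D (y : n.-tuple RT) : R := (del * (1 + 2 * k%:R)) * ball_indic y +
  (del * (2 * n.+1%:R)) * \sum_(i < k) ball_indic y * direction y (I i) ^+ 2.
have M0 : 0 <= M by exact: le_trans (fM [tuple 0 | i < k]).
have mF m0 : measurable_fun setT (F m0).
  apply: measurable_fun_ifT => //.
    apply: measurable_fun_ler => //; exact: (measurable_norm2 (@measurable_hyp n)).
  apply: (measurableT_comp (lipschitz_norm2_measurable flip)).
  apply/measurable_fun_tnthP => i.
  rewrite (_ : _ \o _ = fun y => m0 + Num.sqrt (n.+1%:R * (rho - m0 ^+ 2)) * direction y (I i)).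
    apply: measurable_funD => //; apply: measurable_funM => //; exact: measurable_direction.
  by apply/funext => y /=; rewrite !tnth_mktuple.
have mS : measurable_fun setT (fun y : n.-tuple RT => \sum_(i < k) ball_indic y * direction y (I
  i) ^+ 2).
  by apply: measurable_sum => i; exact: measurable_second_moment.
have mb : measurable_fun setT (fun y : n.-tuple RT => ball_indic y) by exact: measurable_ball_indic.
have S0 y : 0 <= \sum_(i < k) ball_indic y * direction y (I i) ^+ 2.
  by apply: sumr_ge0 => i _; exact: second_moment_ge0.
have c1 : 0 <= del * (1 + 2 * k%:R) by rewrite mulr_ge0// addr_ge0// mulr_ge0.
have c2 : 0 <= del * (2 * n.+1%:R) by rewrite mulr_ge0// mulr_ge0.
(* The factor [n.+1] cancels against the bound on each second moment, so the second term of [D]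
   contributes another [2 * k]. *)
have DV : (iint (fun y => (D y)%:E) <= ((1 + 4 * k%:R) * del)%:E * V)%E.
  rewrite /D; under eq_fun do rewrite EFinD !EFinM.
  rewrite iintD; first last.
  - by move=> t; rewrite -EFinM lee_fin mulr_ge0.
  - by move=> t; rewrite -EFinM lee_fin mulr_ge0// ball_indic_ge0.
  - by apply/measurable_EFinP/measurable_funM.
  - by apply/measurable_EFinP/measurable_funM.
  rewrite !iintZl//; try by [apply/measurable_EFinP | move=> t;
    rewrite lee_fin ball_indic_ge0 | move=> t; rewrite lee_fin].
  rewrite iint_sum_ord; last 2 first.
  - by move=> i; exact: measurable_second_moment.
  - by move=> i t; exact: second_moment_ge0.
  rewrite -/V.
  have -> : ((1 + 4 * k%:R) * del)%:E = ((del * (1 + 2 * k%:R))%:E + (del * 2 * k%:R)%:E)%E :>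
    \bar R.
    by rewrite -EFinD; congr EFin; ring.
  rewrite ge0_muleDl ?lee_fin// ?mulr_ge0//.
  apply: leeD => //.
  have -> : (del * (2 * n.+1%:R))%:E = ((del * 2)%:E * n.+1%:R%:E)%E :> \bar R.
    by rewrite -EFinM mulrA.
  rewrite [X in (_ <= X * _)%E]EFinM -!muleA; apply: lee_wpmul2l.
    by rewrite lee_fin mulr_ge0.
  rewrite ge0_sume_distrr; last first.
    by move=> i _; apply: iint_ge0 => t; rewrite lee_fin second_moment_ge0.
  apply: (@le_trans _ _ (\sum_(i < k) V)%E).
    by apply: lee_sum => i _; exact: second_moment_le.
  by rewrite big_const_ord iter_addr addr0 mule_natl.
have D0 y : 0 <= D y by rewrite addr_ge0// mulr_ge0// ball_indic_ge0.
have Doo : (iint (fun y => (D y)%:E) < +oo)%E.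
  apply: le_lt_trans DV _; rewrite -(fineK (x := V)) ?ge0_fin_numE//.
  by rewrite -EFinM ltry.
have vD : 2 * fine (iint (fun y => (D y)%:E)) <= 2 * (1 + 4 * k%:R) * del * fine V.
  rewrite -!mulrA ler_pM2l// mulrA -lee_fin fineK ?EFinM ?fineK ?ge0_fin_numE//.
  by apply: iint_ge0 => t; rewrite lee_fin.
apply: le_trans vD; apply: (lint_dist_le (B := fun y => M * ball_indic y)) => //.
- exact: measurable_funM.
- by apply: measurable_funD; exact: measurable_funM.
- by move=> y; rewrite /F /ball_indic; case: ifP; rewrite ?mulr1 ?mulr0 ?normr0.
- by move=> y; rewrite /F /ball_indic; case: ifP; rewrite ?mulr1 ?mulr0 ?normr0.
- move=> y; have := D0 y; rewrite /F /D /ball_indic; case: ifP => [_ _|_];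
  last by rewrite subrr normr0.
  apply: le_trans (flip _ _) _; rewrite mulr1.
  under [X in _ + _ * X]eq_bigr do rewrite mul1r.
  have -> : norm2 [tuple tnth (proj_sites I (pt m y)) i - tnth (proj_sites I (pt m' y)) i | i < k]
    = Num.sqrt (\sum_(i < k) ((m - m') + Num.sqrt n.+1%:R *
       (Num.sqrt (rho - m ^+ 2) - Num.sqrt (rho - m' ^+ 2)) * direction y (I i)) ^+ 2).
    congr Num.sqrt; apply: eq_bigr => i _; congr (_ ^+ 2).
    by rewrite !tnth_mktuple !sqrtrM//; ring.
  set s := \sum_(i < k) direction y (I i) ^+ 2.
  have s0 : 0 <= s by apply: sumr_ge0 => i _; exact: sqr_ge0.
  set z := 2 * k%:R + 2 * n.+1%:R * s.
  have z0 : 0 <= z by rewrite addr_ge0// ?mulr_ge0// mulr_ge0.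
  have -> : del * (1 + 2 * k%:R) + del * (2 * n.+1%:R) * s = del * (1 + z) by rewrite /z; ring.
  rewrite -(ger0_norm (_ : 0 <= del * (1 + z))); last by rewrite mulr_ge0// addr_ge0.
  rewrite -sqrtr_sqr ler_sqrt ?sqr_ge0//.
  (* The square root is removed by [z <= (1 + z)^2]; the rest splits into one inequality per
     site. *)
  apply: (@le_trans _ _ (del ^+ 2 * z)); last first.
    by rewrite exprMn ler_wpM2l ?sqr_ge0//; nra.
  have -> : del ^+ 2 * z = \sum_(i < k) del ^+ 2 * (2 + 2 * n.+1%:R * direction y (I i) ^+ 2).
    rewrite -mulr_sumr big_split/= -mulr_sumr sumr_const card_ord; congr (_ * (_ + _)).
    by rewrite mulr_natr.
  apply: ler_sum => i _.
  set a := m - m'; set b := Num.sqrt _ - _; set t := direction _ _.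
  have a2 : a ^+ 2 <= del ^+ 2.
    by rewrite -(real_normK (num_real a)) lerXn2r ?nnegrE// lerDl.
  have b2 : b ^+ 2 <= del ^+ 2.
    by rewrite -(real_normK (num_real b)) lerXn2r ?nnegrE// lerDr.
  have N2 : Num.sqrt n.+1%:R ^+ 2 = n.+1%:R :> R by rewrite sqr_sqrtr.
  have Nt : 0 <= n.+1%:R * t ^+ 2 :> R by rewrite mulr_ge0// sqr_ge0.
  apply: (@le_trans _ _ (2 * a ^+ 2 + 2 * b ^+ 2 * (n.+1%:R * t ^+ 2))).
    have := sqr_ge0 (a - Num.sqrt n.+1%:R * b * t).
    have -> : n.+1%:R * t ^+ 2 = (Num.sqrt n.+1%:R * t) ^+ 2 by rewrite [RHS]exprMn N2.
    move: (Num.sqrt n.+1%:R) => w; nra.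
  have := ler_wpM2r Nt b2; nra.
- apply: (@le_lt_trans _ _ (M%:E * V)%E).
    by rewrite -iintZl//; [exact/measurable_EFinP|move=> t; rewrite lee_fin ball_indic_ge0].
  by rewrite -(fineK (x := V)) ?ge0_fin_numE// -EFinM ltry.
Qed.

End sphere.

(** * Integrals with an endpoint singularity *)

Section ftc_variants.
Context {R : realType}.
Local Notation mu := (@lebesgue_measure R).

Lemma is_derive_continuous (f : R -> R) (x d : R) :
  is_derive x 1 f d -> {for x, continuous f}.
Proof.
move=> df; apply: differentiable_continuous; apply/derivable1_diffP.
exact: ex_derive.
Qed.

(** With [P] the running integral of [f], the difference [P - F] has nonnegative derivative inside
    the interval. At the endpoints only continuity of [F] is asked, and [f] may blow up there, as
    the weight does at 0. *)
Lemma FTC_le_integral (f F : R -> R) (a b : R) : a < b ->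
  mu.-integrable `[a, b] (EFin \o f) ->
  {within `[a, b], continuous F} ->
  (forall x, x \in `]a, b[ -> {for x, continuous f}) ->
  (forall x, x \in `]a, b[ -> exists2 d, is_derive x 1 F d & d <= f x) ->
  F b - F a <= \int[mu]_(x in `[a, b]) f x.
Proof.
move=> ab intf cF cf dF.
pose P x := parameterized_integral mu a x f.
have cP : {within `[a, b], continuous P}.
  exact: (parameterized_integral_continuous (ltW ab) intf).
have dP x : x \in `]a, b[ -> derivable P x 1 /\ derive1 P x = f x.
  move=> xab; apply: (@continuous_FTC1_closed _ f a x b) => //.
  - by rewrite (itvP xab).
  - by rewrite (itvP xab).
  - exact: cf.
have : (P - F) a <= (P - F) b.
  apply: (@ger0_derive1_ndecr _ (P - F) a b) => //; last exact: ltW.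
  - move=> x xab; have [d [dFx _] _] := dF x xab.
    by apply: derivableB => //; exact: (dP x xab).1.
  - move=> x xab; have [d dFx dle] := dF x xab; have [dPx Pf] := dP x xab.
    rewrite derive1E deriveB//.
    by rewrite -derive1E Pf (@derive_val _ _ _ _ _ _ _ dFx) subr_ge0.
  - by move=> x; apply: continuousB; [exact: cP|exact: cF].
have Pa : P a = 0 by rewrite /P /parameterized_integral set_itv1 Rintegral_set1.
by rewrite !fctE Pa sub0r lerBrDr addrC.
Qed.

(** On each [[a, c i]] the fundamental theorem bounds the integral by [F (c i) - F a <= M]; monotone
    convergence along [c i] increasing to [b] transfers the bound. *)
Lemma integrable_singular_right (f F : R -> R) (a b M : R) : a < b ->
  measurable_fun `[a, b] f ->
  (forall x, x \in `[a, b] -> 0 <= f x) ->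
  (forall x, x \in `[a, b[ -> {for x, continuous f}) ->
  (forall x, x \in `[a, b[ -> is_derive x 1 F (f x)) ->
  (forall x, x \in `[a, b[ -> F x - F a <= M) ->
  mu.-integrable `[a, b] (EFin \o f).
Proof.
move=> ab mf f0 cf dF FM.
(* [i.+2] keeps [c i] strictly between [a] and [b] already for [i = 0]. *)
pose c (i : nat) : R := b - (b - a) / i.+2%:R.
have cE i : a < c i < b.
  have h : 0 < (b - a) / i.+2%:R < b - a.
    by rewrite divr_gt0 ?subr_gt0//= ltr_pdivrMr// ltr_pMr ?subr_gt0// ltr1n.
  by move: h; rewrite /c; move: (_ / _) => z /andP[? ?]; apply/andP; split; lra.
have sub_itv i : `[a, c i] `<=` `[a, b[.
  by apply: subset_itvl; rewrite bnd_simp; case/andP: (cE i).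
have intc i : (\int[mu]_(x in `[a, c i]) (f x)%:E <= M%:E)%E.
  have /andP[aci cib] := cE i.
  have inab x : x \in `[a, c i] -> x \in `[a, b[ by move=> h; exact: (sub_itv i).
  rewrite (@continuous_FTC2 _ f F)//.
  - by rewrite -EFinB lee_fin FM// in_itv/= ltW//=.
  - apply: continuous_in_subspaceT => x; rewrite inE => xi; exact/cf/inab.
  - split.
    + move=> x xi; have h : x \in `[a, b[ by apply: inab; apply: subset_itv_oo_cc xi.
      by have [] := dF x h.
    + apply: cvg_at_right_filter; apply: is_derive_continuous; apply: dF.
      by rewrite in_itv/= lexx.
    + apply: cvg_at_left_filter; apply: is_derive_continuous; apply: dF.
      by rewrite in_itv/= cib ltW.
  - move=> x xi; have h : x \in `[a, b[ by apply: inab; apply: subset_itv_oo_cc xi.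
    by rewrite derive1E; have := dF x h => dFx; exact: derive_val.
have bigc : \bigcup_i `[a, c i]%classic = `[a, b[%classic.
  apply/seteqP; split => [x [i _]|x]; first exact: sub_itv.
  rewrite /= in_itv/= => /andP[ax xb].
  pose k := Num.truncn ((b - a) / (b - x)).
  exists k => //=; rewrite in_itv/= ax/= /c lerBrDr -lerBrDl.
  rewrite ler_pdivrMr// mulrC -ler_pdivrMr ?subr_gt0//.
  by apply: (le_trans (ltW (truncnS_gt _))); rewrite ler_nat.
have mfo : measurable_fun `[a, b[ (EFin \o f).
  apply/measurable_EFinP; apply: measurable_funS mf => //.
  exact: subset_itv_co_cc.
apply/integrableP; split; first exact/measurable_EFinP.
rewrite [ltLHS](_ : _ = \int[mu]_(x in `[a, b]) (f x)%:E)%E; last first.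
  by apply: eq_integral => x; rewrite inE => xab /=; rewrite ger0_norm// f0.
rewrite -integral_itv_bndo_bndc// -bigc.
apply: (@le_lt_trans _ _ M%:E); last by rewrite ltry.
have cv : (\int[mu]_(x in `[a, c i]) (f x)%:E @[i --> \oo] --> \int[mu]_(x in \bigcup_i `[a, c
  i]%classic) (f x)%:E)%E.
  apply: (@ge0_nondecreasing_set_cvg_integral _ (measurableTypeR R) R (fun i => `[a, c
    i]%classic) (EFin \o f) mu).
  - apply/nondecreasing_seqP => i; rewrite subsetEset; apply: subset_itvl.
    rewrite bnd_simp /c lerD2l lerN2 ler_wpM2l ?subr_ge0 ?(ltW ab)//.
    by rewrite lef_pV2 ?posrE// ler_nat.
  - by move=> i.
  - move=> i; apply: measurable_funS mfo => //; exact: sub_itv.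
  - move=> i x /sub_itv xab; rewrite lee_fin f0//; exact: subset_itv_co_cc xab.
rewrite -(cvg_lim _ cv)//; apply: lime_le; first by apply/cvg_ex; eexists; exact: cv.
by apply: nearW => i; exact: intc.
Qed.

End ftc_variants.

(** * Concentration of the canonical weight *)

Lemma continuous_mulr (R : realType) (f g : R -> R) (x : R) :
  {for x, continuous f} -> {for x, continuous g} ->
  {for x, continuous (fun y => f y * g y)}.
Proof. exact: continuousM. Qed.

Lemma continuous_addr (R : realType) (f g : R -> R) (x : R) :
  {for x, continuous f} -> {for x, continuous g} ->
  {for x, continuous (fun y => f y + g y)}.
Proof. exact: continuousD. Qed.

Lemma continuous_subr (R : realType) (f g : R -> R) (x : R) :
  {for x, continuous f} -> {for x, continuous g} ->
  {for x, continuous (fun y => f y - g y)}.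
Proof. exact: continuousB. Qed.

Section weight.
Context {R : realType}.
Local Notation mu := (@lebesgue_measure R).
Variables (J rho beta : R) (p : nat).
Hypotheses (J0 : 0 < J) (rho0 : 0 < rho).
Local Notation N := (p.+3%:R : R).

Definition mag (e : R) : R := Num.sqrt (- (2 * e) / J).
Definition spread (e : R) : R := Num.sqrt (rho + 2 * e / J).
(** With [N = p + 3], the power [(N - 3) / 2] of [rho + 2 * e / J] is the natural power [p] of its
    square root, so no real exponent remains. *)
Definition weight (e : R) : R := expR (- beta * e * N) * spread e ^+ p / mag e.
Local Notation emin := (- (rho * J) / 2).

Lemma weightE (e : R) : emin <= e ->
  weight e = expR (- beta * e * N) * Z_MC p.+2 J e rho.
Proof.
move=> ae; rewrite /weight /Z_MC -mulrA; congr (_ * (_ / _)).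
have u0 : 0 <= rho + 2 * e / J.
  have : rho * J + 2 * e >= 0 by lra.
  by move=> h; rewrite -(pmulr_lge0 _ J0) mulrDl divfK ?gt_eqF// addrC.
rewrite (_ : (p.+3%:R - 3) / 2 = 2^-1 * p%:R); last first.
  by rewrite -addn3 natrD addrK mulrC.
by rewrite powRrM powR_mulrn ?powR_ge0// powR12_sqrt.
Qed.

Lemma continuous_affine (c d : R) : continuous (fun e : R => c * e + d).
Proof.
move=> x; apply continuous_addr; last exact: cst_continuous.
by apply continuous_mulr; [exact: cst_continuous|exact: id].
Qed.

Lemma continuous_mag : continuous mag.
Proof.
move=> x; apply: (@continuous_comp _ _ _ (fun e : R => - (2 * e) / J) Num.sqrt);
  last exact: sqrt_continuous.
rewrite (_ : (fun e => _) = fun e : R => (- 2 / J) * e + 0); first exact: continuous_affine.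
by apply/funext => e; ring.
Qed.

Lemma continuous_spread : continuous spread.
Proof.
move=> x; apply: (@continuous_comp _ _ _ (fun e : R => rho + 2 * e / J) Num.sqrt);
  last exact: sqrt_continuous.
rewrite (_ : (fun e => _) = fun e : R => (2 / J) * e + rho); first exact: continuous_affine.
by apply/funext => e; ring.
Qed.

Lemma continuous_sqr_mag : continuous (fun e => mag e ^+ 2).
Proof. by move=> x; apply: (@continuous_comp _ _ _ mag (fun y => y ^+ 2));
  [exact: continuous_mag|exact: exprn_continuous]. Qed.

Lemma continuous_expR_affine (c d : R) : continuous (fun e => expR (c * e * d)).
Proof.
move=> x; apply: (@continuous_comp _ _ _ (fun e : R => c * e * d) (@expR R));
  last exact: continuous_expR.
rewrite (_ : (fun e => _) = fun e : R => (c * d) * e + 0); first exact: continuous_affine.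
by apply/funext => e; ring.
Qed.

Lemma continuous_expR_spread : continuous (fun e => expR (- beta * e * N) * spread e ^+ p).
Proof.
move=> x; apply continuous_mulr.
  exact: continuous_expR_affine.
by apply: (@continuous_comp _ _ _ spread (fun y => y ^+ p));
  [exact: continuous_spread|exact: exprn_continuous].
Qed.

Lemma is_derive_affine (c d x : R) : is_derive x 1 (fun e : R => c * e + d) c.
Proof.
have h : is_derive x 1 ((c \*: id : R -> R) + cst d) (c *: 1 + 0) by exact: _.
by apply: (is_derive_eq h); rewrite addr0 /GRing.scale/= mulr1.
Qed.

Lemma mag_gt0 (e : R) : e < 0 -> 0 < mag e.
Proof. by move=> e0; rewrite sqrtr_gt0 divr_gt0// oppr_gt0 pmulr_rlt0. Qed.

Lemma sqr_mag (e : R) : e <= 0 -> mag e ^+ 2 = - (2 * e) / J.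
Proof. by move=> e0; rewrite sqr_sqrtr// divr_ge0 ?(ltW J0)// oppr_ge0 pmulr_rle0. Qed.

Lemma spread_arg_gt0 (e : R) : emin < e -> 0 < rho + 2 * e / J.
Proof.
move=> ae; rewrite -(pmulr_lgt0 _ J0) mulrDl divfK ?gt_eqF//.
by lra.
Qed.

Lemma spread_gt0 (e : R) : emin < e -> 0 < spread e.
Proof. by move=> ae; rewrite sqrtr_gt0 spread_arg_gt0. Qed.

Lemma spread_start : spread emin = 0.
Proof.
rewrite /spread (_ : rho + _ = 0) ?sqrtr0//.
by field; rewrite gt_eqF.
Qed.

Lemma mag_end : mag 0 = 0.
Proof. by rewrite /mag mulr0 oppr0 mul0r sqrtr0. Qed.

Lemma sqr_spread (e : R) : emin <= e -> spread e ^+ 2 = rho + 2 * e / J.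
Proof.
rewrite le_eqVlt => /predU1P[<-|ae]; last by rewrite sqr_sqrtr// ltW// spread_arg_gt0.
rewrite spread_start expr0n /=; field; by rewrite gt_eqF.
Qed.

Lemma sqr_spread_mag (e : R) : emin <= e -> e <= 0 -> spread e ^+ 2 = rho - mag e ^+ 2.
Proof. by move=> ae e0; rewrite sqr_spread// sqr_mag//; ring. Qed.

Lemma is_derive_mag (e : R) : e < 0 -> is_derive e 1 mag (- (J * mag e)^-1).
Proof.
move=> e0; have h : is_derive e 1 (fun e : R => (- 2 / J) * e + 0) (- 2 / J) by exact:
  is_derive_affine.
have E : (fun e : R => (- 2 / J) * e + 0) = (fun e : R => - (2 * e) / J).
  by apply/funext => x; ring.
rewrite E in h.
have pos : 0 < - (2 * e) / J by have := mag_gt0 e0; rewrite sqrtr_gt0.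
have h2 := @is_derive1_comp _ Num.sqrt (fun e : R => - (2 * e) / J) e _ _ (is_derive1_sqrt pos) h.
have -> : - (J * mag e)^-1 = (2 * Num.sqrt (- (2 * e) / J))^-1 * (- 2 / J); last exact: h2.
rewrite -/(mag e); field.
by rewrite !gt_eqF ?mag_gt0.
Qed.

Lemma is_derive_spread (e : R) : emin < e -> is_derive e 1 spread (J * spread e)^-1.
Proof.
move=> ae; have h : is_derive e 1 (fun e : R => (2 / J) * e + rho) (2 / J) by exact:
  is_derive_affine.
have E : (fun e : R => (2 / J) * e + rho) = (fun e : R => rho + 2 * e / J).
  by apply/funext => x; ring.
rewrite E in h.
have h2 := @is_derive1_comp _ Num.sqrt (fun e : R => rho + 2 * e / J) e _ _ (is_derive1_sqrt
  (spread_arg_gt0 ae)) h.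
have -> : (J * spread e)^-1 = (2 * Num.sqrt (rho + 2 * e / J))^-1 * (2 / J); last exact: h2.
rewrite -/(spread e); field.
by rewrite !gt_eqF ?spread_gt0.
Qed.

Lemma aneg : emin < 0.
Proof. by rewrite mulNr oppr_lt0 divr_gt0// mulr_gt0. Qed.

Lemma continuous_inv_mag (e : R) : e < 0 -> {for e, continuous (fun e => (mag e)^-1)}.
Proof.
move=> e0; apply: continuousV; last exact: continuous_mag.
by rewrite gt_eqF// mag_gt0.
Qed.

(** [- J * mag] is a primitive of [1 / mag] that stays bounded up to the singular endpoint 0. *)
Lemma integrable_inv_mag : mu.-integrable `[emin, 0] (EFin \o (fun e => (mag e)^-1)).
Proof.
apply: (@integrable_singular_right _ _ (fun e => - J * mag e) emin 0 (J * mag emin)).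
- exact: aneg.
- apply: measurable_funTS.
  rewrite (_ : (fun _ => _) = fun e => powR (mag e) (-1)).
    exact: (measurableT_comp (measurable_powR _) (continuous_measurable_fun continuous_mag)).
  by apply/funext => e; rewrite powR_inv1// sqrtr_ge0.
- by move=> x _; rewrite invr_ge0 sqrtr_ge0.
- by move=> x; rewrite in_itv/= => /andP[_ x0]; exact: continuous_inv_mag.
- move=> x; rewrite in_itv/= => /andP[_ x0].
  have h := is_derive_mag x0.
  have h' : is_derive x 1 (- J \*: mag : R -> R) (- J *: (- (J * mag x)^-1)) by exact: _.
  apply: (is_derive_eq h'); rewrite /GRing.scale/=; field.
  by rewrite !gt_eqF ?mag_gt0.
- move=> x; rewrite in_itv/= => /andP[_ x0].
  have h : 0 < J * mag x by rewrite mulr_gt0 ?mag_gt0.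
  by rewrite /= !mulNr opprK gerDr oppr_le0 ltW.
Qed.

(** The singular factor [1 / mag] is integrable, and the other factors are continuous, hence
    bounded, on the compact energy range. *)
Lemma weight_integrable (g : R -> R) : continuous g ->
  mu.-integrable `[emin, 0] (EFin \o (fun e => weight e * g e)).
Proof.
move=> cg; pose r (e : R) : R := (mag e)^-1.
pose h (e : R) : R := expR (- beta * e * N) * spread e ^+ p * g e.
have ch : continuous h.
  move=> x; rewrite /h; apply continuous_mulr; last exact: cg.
  exact: continuous_expR_spread.
rewrite (_ : EFin \o _ = ((EFin \o r) \* (EFin \o h))%E); last first.
  by apply/funext => e; rewrite /= -EFinM; congr EFin; rewrite /h /r /weight; ring.
apply: integrableMl => //; first exact: integrable_inv_mag.
  apply: measurable_funTS; exact: (continuous_measurable_fun ch).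
have [M [Mr hM]] : bounded_set (h @` `[emin, 0]).
  apply: compact_bounded; apply: continuous_compact; last exact: segment_compact.
  exact: continuous_subspaceT.
exists M; split => // x Mx y yab; apply: (hM x Mx); by exists y.
Qed.

Lemma weight_integrable1 : mu.-integrable `[emin, 0] (EFin \o weight).
Proof.
have := weight_integrable (@cst_continuous R R (1 : R)).
by congr (_.-integrable _ _); apply/funext => e /=; rewrite mulr1.
Qed.

Lemma weight_ge0 (e : R) : 0 <= weight e.
Proof. by rewrite /weight divr_ge0 ?sqrtr_ge0// mulr_ge0 ?expR_ge0// exprn_ge0// sqrtr_ge0. Qed.

Lemma continuous_weight (e : R) : e < 0 -> {for e, continuous weight}.
Proof. by move=> e0; apply continuous_mulr;
  [exact: continuous_expR_spread|exact: continuous_inv_mag]. Qed.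

Lemma is_derive_expR_affine (c d x : R) :
  is_derive x 1 (fun e => expR (c * e * d)) (c * d * expR (c * x * d)).
Proof.
have h : is_derive x 1 (fun e : R => (c * d) * e + 0) (c * d) by exact: is_derive_affine.
have E : (fun e : R => (c * d) * e + 0) = (fun e : R => c * e * d).
  by apply/funext => y; ring.
rewrite E in h.
have h2 := is_derive_expR (c * x * d).
rewrite mulrC; exact: (@is_derive1_comp _ (@expR R) (fun e : R => c * e * d) x _ _ h2 h).
Qed.

(* The derivative of [exp (- beta e N) spread^n mag * h (mag^2)] is [weight / J]
   times the left-hand side of the last hypothesis, and this primitive vanishes
   at both ends of the energy range. *)
Lemma weight_moment_le (h h' chi : R -> R) (A C : R) :
  (forall v, 0 <= v <= rho -> {for v, continuous h}) ->
  (forall v, 0 < v < rho -> is_derive v 1 h (h' v)) ->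
  continuous chi ->
  (forall v, 0 < v < rho ->
    (p.+2%:R - beta * J * N * (rho - v)) * v * h v - (rho - v) * h v
      - 2 * (rho - v) * v * h' v <= C - A * chi v) ->
  A * (\int[mu]_(e in `[emin, 0]) (weight e * chi (mag e ^+ 2))) <=
  C * (\int[mu]_(e in `[emin, 0]) weight e).
Proof.
move=> ch dh cchi hle.
have cchim : continuous (fun e => chi (mag e ^+ 2)).
  by move=> x; apply: (@continuous_comp _ _ _ (fun e => mag e ^+ 2) chi);
    [exact: continuous_sqr_mag|exact: cchi].
pose F e := expR (- beta * e * N) * spread e ^+ p.+2 * (mag e * h (mag e ^+ 2)).
pose g1 (e : R) : R := C - A * chi (mag e ^+ 2).
have cg1 : continuous g1.
  move=> x; rewrite /g1; apply continuous_subr; first exact: cst_continuous.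
  by apply continuous_mulr; [exact: cst_continuous|exact: cchim].
pose g (e : R) : R := g1 e / J.
have cg : continuous g.
  by move=> x; rewrite /g; apply continuous_mulr; [exact: cg1|exact: cst_continuous].
have vrange e : emin <= e -> e <= 0 -> 0 <= mag e ^+ 2 <= rho.
  move=> ae e0; rewrite sqr_ge0/= -subr_ge0 -sqr_spread_mag// sqr_ge0//.
have : F 0 - F emin <= \int[mu]_(e in `[emin, 0]) (weight e * g e).
  apply: FTC_le_integral.
  - exact: aneg.
  - exact: weight_integrable.
  - apply: continuous_in_subspaceT => x; rewrite inE/= in_itv/= => /andP[ax x0].
    apply continuous_mulr.
      apply continuous_mulr; first exact: continuous_expR_affine.
      by apply: (@continuous_comp _ _ _ spread (fun y => y ^+ p.+2));
        [exact: continuous_spread|exact: exprn_continuous].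
    apply continuous_mulr; first exact: continuous_mag.
    apply: (@continuous_comp _ _ _ (fun e => mag e ^+ 2) h); first exact: continuous_sqr_mag.
    exact/ch/vrange.
  - move=> x; rewrite in_itv/= => /andP[ax x0].
    by apply continuous_mulr; [exact: continuous_weight|exact: cg].
  - move=> x; rewrite in_itv/= => /andP[ax x0].
    have m0 := mag_gt0 x0; have s0 := spread_gt0 ax.
    have sE : spread x ^+ 2 = rho - mag x ^+ 2 by rewrite sqr_spread_mag// ltW.
    have vr : 0 < mag x ^+ 2 < rho by rewrite exprn_gt0//= -subr_gt0 -sE exprn_gt0.
    have d1 := is_derive_expR_affine (- beta) N x.
    have d2 := is_derive_spread ax.
    have d2n : is_derive x 1 (spread ^+ p.+2) ((p.+2%:R * spread x ^+ p.+1) *: (J * spread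
      x)^-1) by exact: _.
    have d3 := is_derive_mag x0.
    have d3n : is_derive x 1 (mag ^+ 2) ((2%:R * mag x ^+ 1) *: (- (J * mag x)^-1)) by exact: _.
    have d4 := dh _ vr.
    have d4n : is_derive x 1 (h \o (mag ^+ 2)) (h' (mag x ^+ 2) * ((2%:R * mag x ^+ 1) *: (- (J
      * mag x)^-1))).
      by apply: is_derive1_comp.
    have spreadX : spread ^+ p.+2 = (fun e => spread e ^+ p.+2) by apply/funext => y;
      rewrite exprfctE.
    rewrite spreadX in d2n.
    have dF := is_deriveM (is_deriveM d1 d2n) (is_deriveM d3 d4n).
    eexists; first exact: dF.
    have := hle _ vr; rewrite -sE => hx.
    (* The derivative of [F] equals this middle expression exactly; the inequality comes only from
       the hypothesis on [h]. *)
    apply: (@le_trans _ _ (weight x * (((p.+2%:R - beta * J * N * spread x ^+ 2) * mag x ^+ 2 *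
      h (mag x ^+ 2) - spread x ^+ 2 * h (mag x ^+ 2) - 2 * spread x ^+ 2 * mag x ^+ 2 * h' (mag
      x ^+ 2)) / J))); last first.
      by rewrite /g /g1 ler_wpM2l ?weight_ge0// ler_pM2r ?invr_gt0.
    rewrite /weight /GRing.scale/= !fctE /=.
    move: (h' _) (h _) => H' H.
    rewrite le_eqVlt; apply/orP; left; apply/eqP.
    rewrite !exprS; move: (spread x ^+ p) => s.
    field; by rewrite !gt_eqF.
have -> : F 0 = 0 by rewrite /F mag_end mul0r mulr0.
have -> : F emin = 0 by rewrite /F spread_start exprS mul0r mulr0 mul0r.
rewrite subrr.
have -> : \int[mu]_(e in `[emin, 0]) (weight e * g e) =
    (C * \int[mu]_(e in `[emin, 0]) weight e - A * \int[mu]_(e in `[emin, 0]) (weight e * chi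
      (mag e ^+ 2))) / J.
  rewrite -RintegralZl//; last exact: weight_integrable1.
  rewrite -RintegralZl//; last exact: weight_integrable.
  have iC : mu.-integrable `[emin, 0] (EFin \o (fun e => C * weight e)).
    have := @weight_integrable (cst C) (@cst_continuous R R C).
    by congr (_.-integrable _ _); apply/funext => e /=; rewrite mulrC.
  have iA : mu.-integrable `[emin, 0] (EFin \o (fun e => A * (weight e * chi (mag e ^+ 2)))).
    have := @weight_integrable (fun e => A * chi (mag e ^+ 2)).
    have cA : continuous (fun e => A * chi (mag e ^+ 2)).
      by move=> x; apply continuous_mulr; [exact: cst_continuous|exact: cchim].
    by move=> /(_ cA); congr (_.-integrable _ _); apply/funext => e /=; rewrite mulrCA.
  rewrite -RintegralB// -RintegralZr//; last first.
    have := weight_integrable cg1.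
    by congr (_.-integrable _ _); apply/funext => e /=; congr EFin; rewrite /g1; ring.
  by apply: eq_Rintegral => e _; rewrite /g /g1; ring.
by rewrite pmulr_lge0 ?invr_gt0// subr_ge0.
Qed.

(** The weight dominates the derivative of an explicit polynomial in [e] that is larger at 0 than at
    the lower end. Positivity permits dividing by the partition function. *)
Lemma weight_integral_gt0 : 0 < \int[mu]_(e in `[emin, 0]) weight e.
Proof.
pose E0 := expR (- (`|beta| * `|emin| * N)).
have E00 : 0 < E0 by exact: expR_gt0.
have sr0 : 0 < Num.sqrt rho by rewrite sqrtr_gt0.
(* [K] is chosen so that [F' = E0 * spread^(2p) / sqrt rho ^ (p+1)]; this lies below [weight]
   because the exponential is at least [E0] and both [spread] and [mag] are at most [sqrt rho]. *)
pose K := E0 / (Num.sqrt rho * (p.+1%:R * (2 / J)) * Num.sqrt rho ^+ p).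
have K0 : 0 < K.
  by rewrite divr_gt0// mulr_gt0 ?exprn_gt0// mulr_gt0// mulr_gt0// divr_gt0.
pose F e := K * (rho + 2 * e / J) ^+ p.+1.
have dF (x : R) : is_derive x 1 F (K * (p.+1%:R * (rho + 2 * x / J) ^+ p * (2 / J))).
  have h : is_derive x 1 (fun e : R => (2 / J) * e + rho) (2 / J) by exact: is_derive_affine.
  have E : (fun e : R => (2 / J) * e + rho) = (fun e : R => rho + 2 * e / J).
    by apply/funext => y; ring.
  rewrite E in h.
  pose u (e : R) : R := rho + 2 * e / J.
  have h' : is_derive x 1 (K \*: (u ^+ p.+1) : R -> R) (K *: ((p.+1%:R * u x ^+ p) *: (2 / J))).
    by apply: is_deriveZ; apply: is_deriveX.
  have uX : K \*: (u ^+ p.+1) = F by apply/funext => y; rewrite /= exprfctE.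
  by rewrite uX in h'; exact: h'.
apply: (@lt_le_trans _ _ (F 0 - F emin)).
  rewrite /F -(sqr_spread (lexx emin)) spread_start expr0n/= expr0n/=.
  by rewrite !mulr0 mul0r addr0 subr0 mulr_gt0// exprn_gt0.
apply: FTC_le_integral.
- exact: aneg.
- exact: weight_integrable1.
- apply: continuous_in_subspaceT => x _; apply: is_derive_continuous; exact: dF.
- by move=> x; rewrite in_itv/= => /andP[ax x0]; exact: continuous_weight.
- move=> x; rewrite in_itv/= => /andP[ax x0].
  eexists; first exact: dF.
  have m0 := mag_gt0 x0; have s0 := spread_gt0 ax.
  have sE := sqr_spread_mag (ltW ax) (ltW x0).
  have sr : spread x <= Num.sqrt rho.
    by rewrite /spread ler_sqrt ?(ltW rho0)// -(sqr_spread (ltW ax)) sE gerBl sqr_ge0.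
  have mr : mag x <= Num.sqrt rho.
    by rewrite /mag ler_sqrt ?(ltW rho0)// -(sqr_mag (ltW x0)) -subr_ge0 -sE sqr_ge0.
  have EE : E0 <= expR (- beta * x * N).
    rewrite ler_expR (_ : - beta * x * N = - (beta * x * N)); last by ring.
    rewrite lerN2 ler_wpM2r//.
    rewrite (le_trans (ler_norm _))// normrM ler_wpM2l//.
    by rewrite !ltr0_norm ?aneg// lerN2 ltW.
  rewrite -(sqr_spread (ltW ax)) -exprM mulnC exprM expr2 /weight.
  have s0p : 0 < spread x ^+ p by rewrite exprn_gt0.
  have srp : spread x ^+ p <= Num.sqrt rho ^+ p by rewrite lerXn2r ?nnegrE// ltW.
  have -> : K * (p.+1%:R * (spread x ^+ p * spread x ^+ p) * (2 / J)) =
     E0 * spread x ^+ p * (spread x ^+ p / Num.sqrt rho ^+ p) / Num.sqrt rho.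
    rewrite /K; field.
    by rewrite !gt_eqF// exprn_gt0.
  have r0 : 0 < spread x ^+ p / Num.sqrt rho ^+ p by rewrite divr_gt0 ?exprn_gt0.
  have r1 : spread x ^+ p / Num.sqrt rho ^+ p <= 1.
    by rewrite ler_pdivrMr ?exprn_gt0// mul1r.
  have m1 : (Num.sqrt rho)^-1 <= (mag x)^-1 by rewrite lef_pV2 ?posrE.
  apply: ler_pM => //.
  - by apply: mulr_ge0; [rewrite mulr_ge0// ltW|exact: ltW].
  - rewrite -[leRHS]mulr1; apply: ler_pM => //; last by rewrite ler_pM2r.
      by rewrite ltW// mulr_gt0.
    by rewrite ltW.
Qed.

(** The moment hypothesis bounds the weighted mean of [chi] by [C / (A * N)]; multiplied by [sqrt N]
    this has the same order [1 / sqrt N] as the additive term. *)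
Lemma weighted_mean_dist (chi g : R -> R) (g0 A C K : R) :
  continuous chi -> continuous g -> 0 < A -> 0 <= K ->
  (forall e, emin <= e <= 0 ->
     `|g e - g0| <= K * (Num.sqrt N * chi (mag e ^+ 2) + (Num.sqrt N)^-1)) ->
  (A * N) * (\int[mu]_(e in `[emin, 0]) (weight e * chi (mag e ^+ 2))) <=
    C * (\int[mu]_(e in `[emin, 0]) weight e) ->
  `| g0 - (\int[mu]_(e in `[emin, 0]) (weight e * g e)) / (\int[mu]_(e in `[emin, 0]) weight e) |
    <= K * (C / A + 1) / Num.sqrt N.
Proof.
move=> cchi cg A0 K0 gle mom.
have W0 := weight_integral_gt0; set W := \int[mu]_(e in _) weight e in W0 mom *.
have cchim : continuous (fun e => chi (mag e ^+ 2)).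
  by move=> x; apply: (@continuous_comp _ _ _ (fun e => mag e ^+ 2) chi);
    [exact: continuous_sqr_mag|exact: cchi].
have cgg : continuous (fun e => g e - g0).
  by move=> x; apply continuous_subr; [exact: cg|exact: cst_continuous].
have E : (\int[mu]_(e in `[emin, 0]) (weight e * g e)) - g0 * W = \int[mu]_(e in `[emin, 0])
  (weight e * (g e - g0)).
  rewrite -RintegralZl//; last exact: weight_integrable1.
  rewrite -RintegralB//; first by apply: eq_Rintegral => e _; ring.
    exact: weight_integrable.
  have := @weight_integrable (cst g0) (@cst_continuous R R g0).
  by congr (_.-integrable _ _); apply/funext => e /=; rewrite mulrC.
rewrite distrC (_ : _ / W - g0 = (\int[mu]_(e in `[emin, 0]) (weight e * (g e - g0))) / W);
  last first.
  by rewrite -E; field; rewrite gt_eqF.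
rewrite normrM normfV (gtr0_norm W0) ler_pdivrMr//.
have sN : 0 < Num.sqrt N by rewrite sqrtr_gt0.
have NE : N = Num.sqrt N * Num.sqrt N by rewrite -expr2 sqr_sqrtr.
have cb : continuous (fun e => Num.sqrt N * chi (mag e ^+ 2) + (Num.sqrt N)^-1).
  move=> x; apply continuous_addr; last exact: cst_continuous.
  by apply continuous_mulr; [exact: cst_continuous|exact: cchim].
have cKb : continuous (fun e => K * (Num.sqrt N * chi (mag e ^+ 2) + (Num.sqrt N)^-1)).
  by move=> x; apply continuous_mulr; [exact: cst_continuous|exact: cb].
apply: (le_trans (le_normr_Rintegral _ _)) => //; first exact: weight_integrable.
apply: (@le_trans _ _ (\int[mu]_(e in `[emin, 0]) (weight e * (K * (Num.sqrt N * chi (mag e ^+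
  2) + (Num.sqrt N)^-1))))).
  apply: le_Rintegral => //.
  - have := integrable_norm (weight_integrable cgg); exact.
  - exact: weight_integrable.
  - move=> e; rewrite /= in_itv/= => eab; rewrite normrM ger0_norm ?weight_ge0//.
    by rewrite ler_wpM2l ?weight_ge0// gle.
have iX : mu.-integrable `[emin, 0] (EFin \o (fun e => weight e * chi (mag e ^+ 2))) by exact:
  weight_integrable.
have -> : \int[mu]_(e in `[emin, 0]) (weight e * (K * (Num.sqrt N * chi (mag e ^+ 2) + (Num.sqrt
  N)^-1))) =
  K * Num.sqrt N * (\int[mu]_(e in `[emin, 0]) (weight e * chi (mag e ^+ 2))) + K / Num.sqrt N * W.
  rewrite -RintegralZl// -RintegralZl//; last exact: weight_integrable1.
  rewrite -RintegralD//; first by apply: eq_Rintegral => e _; ring.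
    have := @weight_integrable (fun e => K * Num.sqrt N * chi (mag e ^+ 2)).
    have cA : continuous (fun e => K * Num.sqrt N * chi (mag e ^+ 2)).
      by move=> x; apply continuous_mulr; [exact: cst_continuous|exact: cchim].
    by move=> /(_ cA); congr (_.-integrable _ _); apply/funext => e /=; rewrite mulrCA.
  have := @weight_integrable (cst (K / Num.sqrt N)) (@cst_continuous R R _).
  by congr (_.-integrable _ _); apply/funext => e /=; rewrite mulrC.
have : K / (A * Num.sqrt N) * ((A * N) * \int[mu]_(e in `[emin, 0]) (weight e * chi (mag e ^+
  2))) <= K / (A * Num.sqrt N) * (C * W).
  by apply: ler_wpM2l => //; rewrite divr_ge0// mulr_ge0// ltW.
set X := Rintegral _ _ _.
have -> : K / (A * Num.sqrt N) * (A * N * X) = K * Num.sqrt N * X.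
  rewrite {2}NE; field; by rewrite !gt_eqF.
have -> : K * (C / A + 1) / Num.sqrt N * W = K / (A * Num.sqrt N) * (C * W) + K / Num.sqrt N * W.
  field; by rewrite !gt_eqF.
by rewrite lerD2r.
Qed.

End weight.

(** * Comparison of the two ensembles *)

Section real_bounds.
Context {R : realType}.

(** Trades a linear deviation for a squared one, so that second-moment concentration suffices; with
    [z = sqrt N * x] it reads [z <= z^2 + 1]. *)
Lemma amgm_sqrt (N x : R) : 0 < N -> 0 <= x ->
  x <= Num.sqrt N * x ^+ 2 + (Num.sqrt N)^-1.
Proof.
move=> N0 x0; have s0 : 0 < Num.sqrt N by rewrite sqrtr_gt0.
move: (Num.sqrt N) s0 => s s0.
have -> : s * x ^+ 2 + s^-1 = ((s * x) ^+ 2 + 1) / s by field; rewrite gt_eqF.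
rewrite ler_pdivlMr// mulrC.
have := sqr_ge0 (s * x - 1); have : 0 <= s * x by rewrite mulr_ge0 ?(ltW s0).
move: (s * x) => z; nra.
Qed.

Lemma sqrt_dist_le (x y : R) : 0 <= x -> 0 < y ->
  `|Num.sqrt x - Num.sqrt y| <= `|x - y| / Num.sqrt y.
Proof.
move=> x0 y0; have sy : 0 < Num.sqrt y by rewrite sqrtr_gt0.
rewrite ler_pdivlMr//.
rewrite [leRHS](_ : _ = `|Num.sqrt x - Num.sqrt y| * `|Num.sqrt x + Num.sqrt y|); last first.
  by rewrite -normrM -subr_sqr !sqr_sqrtr// ltW.
rewrite ler_wpM2l// ger0_norm ?addr_ge0 ?sqrtr_ge0//.
by rewrite lerDr sqrtr_ge0.
Qed.

(** Since [(N - 1) - N * (rho - v) / (rho - v0) = N * (v - v0) / (rho - v0) - 1], this [h] turns the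
    order-[N] part of the first term into a nonpositive multiple of [(v - v0)^2]. The difficulty is
    the term with [h'], which can reach order [N] near [v = 0]. *)
Lemma drift_bound (rho v0 : R) : 0 < v0 < rho ->
  exists kappa A C : R, [/\ 0 < kappa, 0 < A &
    forall N v : R, kappa <= N -> 0 < v < rho ->
    let h := - (v - v0) / (v + kappa / N) in
    let h' := - (v0 + kappa / N) / (v + kappa / N) ^+ 2 in
    ((N - 1) - (rho - v0)^-1 * N * (rho - v)) * v * h - (rho - v) * h
      - 2 * (rho - v) * v * h' <= C - A * N * (v - v0) ^+ 2].
Proof.
move=> /andP[v00 v0r]; have rho0 : 0 < rho := lt_trans v00 v0r.
pose u0 := rho - v0; have u00 : 0 < u0 by rewrite subr_gt0.
(* This kappa makes the drift dominate the pole of [h'] when [v <= v0 / 2]. *)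
pose kappa := 4 * rho * (v0 + 1) * u0 / v0 ^+ 2.
have k0 : 0 < kappa.
  by rewrite divr_gt0 ?exprn_gt0// mulr_gt0// mulr_gt0 ?addr_gt0// mulr_gt0.
(* [A1] is the rate for [v <= v0 / 2]; [A2] is the rate for [v > v0 / 2], where
   [v / (v + kappa / N) >= v0 / (v0 + 2)]. *)
pose A1 := rho / (2 * kappa * v0); pose A2 := v0 / ((v0 + 2) * u0).
have A10 : 0 < A1 by rewrite divr_gt0// mulr_gt0// mulr_gt0.
have A20 : 0 < A2 by rewrite divr_gt0// mulr_gt0// addr_gt0.
pose C := rho + 2 * rho * (v0 + 1) / v0.
have Crho : rho <= C by rewrite lerDl divr_ge0 ?(ltW v00)// mulr_ge0 ?addr_ge0 ?mulr_ge0 ?(ltW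
  v00) ?(ltW rho0).
exists kappa, (Num.min A1 A2), C; split=> // [|N v kN /andP[vp vr]].
  by rewrite lt_min A10.
rewrite -/u0.
have N0 : 0 < N by apply: lt_le_trans kN.
pose w := kappa / N; rewrite /= -/w.
have w0 : 0 < w by rewrite divr_gt0.
have w1 : w <= 1 by rewrite ler_pdivrMr// mul1r.
have NE : N = kappa / w by rewrite /w; field; rewrite !gt_eqF.
set q := v + w; have q0 : 0 < q by rewrite addr_gt0.
pose P := v0 + w; have P0 : 0 < P by rewrite addr_gt0.
have AN z : 0 <= z -> Num.min A1 A2 * N * z <= A1 * N * z /\ Num.min A1 A2 * N * z <= A2 * N * z.
  by move=> z0; split; rewrite -!(mulrA _ N z) ler_wpM2r ?mulr_ge0 ?(ltW N0)// ge_min lexx ?orbT.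
have [b1 b2] := AN _ (sqr_ge0 (v - v0)).
pose X := N * v * (v - v0) ^+ 2 / (u0 * q).
(* The identity isolates the restoring drift [X]; the only other term that can be large is the pole
   [rho * P * (v - w) / q^2]. *)
have TE : ((N - 1) - u0^-1 * N * (rho - v)) * v * (- (v - v0) / q) - (rho - v) * (- (v - v0) / q)
      - 2 * (rho - v) * v * (- P / q ^+ 2) =
   rho + rho * P * (v - w) / q ^+ 2 - 2 * v ^+ 2 * P / q ^+ 2 - X.
  rewrite /X /P /u0; have : q != 0 by rewrite gt_eqF.
  have : u0 != 0 by rewrite gt_eqF.
  have -> : v = q - w by rewrite /q; ring.
  by rewrite /u0; move=> ? ?; field; apply/andP.
rewrite TE {TE}.
have t0 : 0 <= 2 * v ^+ 2 * P / q ^+ 2.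
  by rewrite divr_ge0 ?sqr_ge0// mulr_ge0 ?(ltW P0)// mulr_ge0 ?sqr_ge0.
have [vs|vs] := leP v (v0 / 2).
(* Near the singularity the pole minus the drift is at most [- (rho * P / w) * (v^2 + w^2) / q^2 <=
   - rho * P / (2 * w)], which is negative of order [N] because [1 / w = N / kappa]. *)
- have hX : rho * P * v / (w * q) <= X.
    have -> : X = (kappa * (v - v0) ^+ 2 / u0) * (v / (w * q)).
      by rewrite /X NE; field; rewrite !gt_eqF.
    rewrite -(mulrA (rho * P) v); apply: ler_wpM2r.
      by rewrite divr_ge0 ?(ltW vp)// mulr_ge0 ?(ltW w0) ?(ltW q0).
    apply: (@le_trans _ _ (rho * (v0 + 1))).
      by rewrite ler_wpM2l ?(ltW rho0)// /P lerD2l.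
    have -> : rho * (v0 + 1) = kappa * (v0 ^+ 2 / 4) / u0.
      by rewrite /kappa; field; rewrite !gt_eqF.
    rewrite ler_wpM2r ?invr_ge0 ?(ltW u00)// ler_wpM2l ?(ltW k0)//.
    nra.
  have e1 : rho * P * (v - w) / q ^+ 2 - rho * P * v / (w * q) =
      - (rho * P / w * ((v ^+ 2 + w ^+ 2) / q ^+ 2)).
    rewrite /q; field; rewrite !gt_eqF//.
  have e2 : 1 / 2 <= (v ^+ 2 + w ^+ 2) / q ^+ 2.
    rewrite ler_pdivlMr ?exprn_gt0// /q; have := sqr_ge0 (v - w); nra.
  have e3 : A1 * N * (v - v0) ^+ 2 <= rho * P / w * (1 / 2).
    have -> : A1 * N * (v - v0) ^+ 2 = rho / w * (1 / 2) * ((v - v0) ^+ 2 / v0).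
      by rewrite /A1 NE; field; rewrite !gt_eqF.
    have -> : rho * P / w * (1 / 2) = rho / w * (1 / 2) * P by ring.
    rewrite ler_wpM2l ?mulr_ge0 ?invr_ge0 ?(ltW rho0) ?(ltW w0)//.
    by rewrite ler_pdivrMr// /P; nra.
  have e4 : rho * P / w * (1 / 2) <= rho * P / w * ((v ^+ 2 + w ^+ 2) / q ^+ 2).
    by rewrite ler_wpM2l// divr_ge0 ?(ltW w0)// mulr_ge0 ?(ltW rho0) ?(ltW P0).
  lra.
(* Away from the singularity the pole is bounded and the drift alone provides the quadratic term. *)
- have hX : A2 * N * (v - v0) ^+ 2 <= X.
    have -> : A2 * N * (v - v0) ^+ 2 = N * (v - v0) ^+ 2 / u0 * (v0 / (v0 + 2)).
      rewrite /A2; field; rewrite !gt_eqF// addr_gt0//.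
    have -> : X = N * (v - v0) ^+ 2 / u0 * (v / q) by rewrite /X; field; rewrite !gt_eqF.
    apply: ler_wpM2l.
      apply: divr_ge0; last exact: ltW.
      by apply: mulr_ge0; [exact: ltW|exact: sqr_ge0].
    rewrite ler_pdivrMr ?addr_gt0// mulrAC ler_pdivlMr// /q; nra.
  (* This supplies the second summand of [C]; it rests on [1 / q <= 2 / v0] and [P <= v0 + 1]. *)
  have hP : rho * P * (v - w) / q ^+ 2 <= 2 * rho * (v0 + 1) / v0.
    have -> : 2 * rho * (v0 + 1) / v0 = rho * ((v0 + 1) * (2 / v0)) by field; rewrite gt_eqF.
    rewrite -!mulrA ler_wpM2l ?(ltW rho0)//.
    apply: (@le_trans _ _ (P * (2 / v0))).
      rewrite ler_wpM2l ?(ltW P0)// ler_pdivrMr ?exprn_gt0//.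
      rewrite mulrAC ler_pdivlMr// /q; nra.
    by rewrite ler_wpM2r ?divr_ge0 ?(ltW v00)// /P lerD2l.
  rewrite /C; lra.
Qed.

End real_bounds.

(** * Ensemble means of a Lipschitz observable *)

Section mc_expectation.
Context {R : realType}.
Variables (J rho : R) (k : nat) (f : k.-tuple R -> R) (M : R).
Hypotheses (J0 : 0 < J) (rho0 : 0 < rho).
Hypothesis fM : forall x, `|f x| <= M.
Hypothesis flip : forall x y : k.-tuple R,
  `|f x - f y| <= norm2 [tuple tnth x i - tnth y i | i < k].

Let L : R := 2 * (1 + 4 * k%:R).
Let L0 : 0 <= L.
Proof. by rewrite mulr_ge0// addr_ge0// mulr_ge0. Qed.

(** For [e >= 0] the square root of a nonpositive number is 0, so both spheres are the one with
    [m = 0]; one formula covers both branches of the definition. *)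
Lemma mc_expectE n (e : R) (G : n.+1.-tuple R -> R) :
  mc_expect J e rho G =
  (mc_sphere_expect (mag J e) rho G + mc_sphere_expect (- mag J e) rho G) / 2.
Proof.
rewrite /mc_expect -/(mag J e); case: ltP => // e0.
rewrite /mag ler0_sqrtr ?oppr0; last first.
  by rewrite pmulr_lle0 ?invr_gt0// oppr_le0 mulr_ge0.
by field.
Qed.

Lemma mc_expect_lipschitz n (I : 'I_k -> 'I_n.+1) (e e' : R) :
  `|mc_expect J e rho (fun phi => f (proj_sites I phi))
    - mc_expect J e' rho (fun phi => f (proj_sites I phi))| <=
  L * (`|mag J e - mag J e'| +
       `|Num.sqrt (rho - mag J e ^+ 2) - Num.sqrt (rho - mag J e' ^+ 2)|).
Proof.
rewrite !mc_expectE.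
have h1 := mc_sphere_lipschitz I (mag J e) (mag J e') rho fM flip.
have := mc_sphere_lipschitz I (- mag J e) (- mag J e') rho fM flip.
rewrite !sqrrN -opprD normrN => h2.
move: h1 h2; rewrite -/L !ler_norml.
move: (L * _) => z /andP[? ?] /andP[? ?]; apply/andP; split; lra.
Qed.

(** Continuity makes the mean integrable against the weight; the Lipschitz bound yields it also
    across [e = 0], where the definition changes branch. *)
Lemma continuous_mc_expect n (I : 'I_k -> 'I_n.+1) :
  continuous (fun e => mc_expect J e rho (fun phi => f (proj_sites I phi))).
Proof.
move=> x; apply/cvgrPdist_lt => eps eps0.
have d0 : 0 < eps / (2 * (L + 1)) by rewrite divr_gt0// mulr_gt0// ltr_wpDl.
have cm := @continuous_mag R J x.
have cq : {for x, continuous (fun e => Num.sqrt (rho - mag J e ^+ 2))}.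
  apply: (@continuous_comp _ _ _ (fun e => rho - mag J e ^+ 2) Num.sqrt);
    last exact: sqrt_continuous.
  apply continuous_subr; first exact: cst_continuous.
  exact: continuous_sqr_mag.
move/cvgrPdist_lt : cm => /(_ _ d0) cm.
move/cvgrPdist_lt : cq => /(_ _ d0) cq.
near=> y; apply: (le_lt_trans (mc_expect_lipschitz I x y)).
have h1 : `|mag J x - mag J y| < eps / (2 * (L + 1)) by near: y.
have h2 : `|Num.sqrt (rho - mag J x ^+ 2) - Num.sqrt (rho - mag J y ^+ 2)| < eps / (2 * (L + 1))
  by near: y.
apply: (@le_lt_trans _ _ (L * (eps / (2 * (L + 1)) + eps / (2 * (L + 1))))).
  by rewrite ler_wpM2l// lerD// ltW.
have -> : L * (eps / (2 * (L + 1)) + eps / (2 * (L + 1))) = L / (L + 1) * eps.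
  by field; rewrite gt_eqF// ltr_wpDl.
by rewrite gtr_pMl// ltr_pdivrMr ?ltr_wpDl// mul1r ltrDl.
Unshelve. all: by end_near. Qed.

Lemma c_expectE (beta : R) p (G : p.+3.-tuple R -> R) :
  c_expect J beta rho G =
  Rintegral (@lebesgue_measure R) `[- (rho * J) / 2, 0]
     (fun e => weight J rho beta p e * mc_expect J e rho G) /
  Rintegral (@lebesgue_measure R) `[- (rho * J) / 2, 0] (weight J rho beta p).
Proof.
rewrite /c_expect; congr (_ / _).
  apply: eq_Rintegral => e; rewrite inE/= in_itv/= => /andP[ae _].
  by rewrite weightE.
apply: eq_Rintegral => e; rewrite inE/= in_itv/= => /andP[ae _].
exact/esym/weightE.
Qed.

(** Common reduction of the two regimes: each supplies its own [h], [chi] and estimate on the two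
    square roots, while concentration and the Lipschitz bound are shared. *)
Lemma expect_dist_le (beta : R) p (I : 'I_k -> 'I_p.+3) (eps : R)
    (h h' chi : R -> R) (A C K : R) :
  (forall v, 0 <= v <= rho -> {for v, continuous h}) ->
  (forall v : R, 0 < v < rho -> is_derive v 1 h (h' v)) ->
  continuous chi -> 0 < A -> 0 <= K ->
  (forall v, 0 < v < rho ->
    (p.+2%:R - beta * J * p.+3%:R * (rho - v)) * v * h v - (rho - v) * h v
      - 2 * (rho - v) * v * h' v <= C - A * p.+3%:R * chi v) ->
  (forall e, - (rho * J) / 2 <= e <= 0 ->
    `|mag J e - mag J eps| + `|Num.sqrt (rho - mag J e ^+ 2) - Num.sqrt (rho - mag J eps ^+ 2)|
     <= K * (Num.sqrt p.+3%:R * chi (mag J e ^+ 2) + (Num.sqrt p.+3%:R)^-1)) ->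
  `|mc_expect J eps rho (fun phi => f (proj_sites I phi))
    - c_expect J beta rho (fun phi => f (proj_sites I phi))|
   <= L * K * (C / A + 1) / Num.sqrt p.+3%:R.
Proof.
move=> ch dh cchi A0 K0 hle mle; rewrite c_expectE.
apply: (@weighted_mean_dist R J rho beta p J0 rho0 chi
  (fun e => mc_expect J e rho (fun phi => f (proj_sites I phi))) _ A C (L * K)
  cchi (@continuous_mc_expect _ I) A0 (mulr_ge0 L0 K0)).
  move=> e eab; apply: (le_trans (mc_expect_lipschitz I e eps)).
  by rewrite -mulrA ler_wpM2l// mle.
exact: (weight_moment_le J0 rho0 ch dh cchi hle).
Qed.

Lemma mc_expect_neg_energy (eps : R) : - (J * rho) / 2 < eps -> eps < 0 ->
  let beta := (1 / J) / (rho + 2 * eps / J) in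
  exists C : R, exists N0 : nat, forall n : nat, (N0 <= n.+1)%N ->
    forall I : 'I_k -> 'I_n.+1, injective I ->
    `| mc_expect J eps rho (fun phi => f (proj_sites I phi))
       - c_expect J beta rho (fun phi => f (proj_sites I phi)) |
      <= C / Num.sqrt (n.+1)%:R.
Proof.
move=> aeps eps0 beta.
have {}aeps : - (rho * J) / 2 < eps by rewrite [rho * J]mulrC.
pose v0 := mag J eps ^+ 2.
have m0 := mag_gt0 J0 eps0; have s0 := spread_gt0 J0 aeps.
have s2 := sqr_spread_mag J0 (ltW aeps) (ltW eps0).
have v00 : 0 < v0 by rewrite exprn_gt0.
have u00 : 0 < rho - v0 by rewrite -s2 exprn_gt0.
have v0r : 0 < v0 < rho by rewrite v00 -subr_gt0.
have [kappa [A [C [k0 A0 drift]]]] := drift_bound v0r.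
(* The two summands are the constants of [sqrt_dist_le] at [v0] and at [rho - v0]. *)
pose K := (mag J eps)^-1 + (Num.sqrt (rho - v0))^-1.
have K0 : 0 <= K by rewrite addr_ge0 ?invr_ge0 ?sqrtr_ge0.
(* The threshold forces [N >= 3], so that [N = p.+3], and [kappa <= N], as the drift bound
   requires. *)
exists (L * K * (C / A + 1)), (Num.truncn kappa).+3 => -[//|[//|p]] pk I _.
have Np : (0 : R) < p.+3%:R by [].
have kN : kappa <= p.+3%:R.
  apply: (le_trans (ltW (truncnS_gt _))); rewrite ler_nat.
  by rewrite (leq_trans _ pk)// !ltnS ltnW.
have w0 : 0 < kappa / p.+3%:R by rewrite divr_gt0.
have q0 v : 0 <= v -> 0 < v + kappa / p.+3%:R by move=> ?; rewrite ltr_wpDl.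
apply: (@expect_dist_le beta p I eps
  (fun v => - (v - v0) / (v + kappa / p.+3%:R))
  (fun v => - (v0 + kappa / p.+3%:R) / (v + kappa / p.+3%:R) ^+ 2)
  (fun v => (v - v0) ^+ 2)) => //.
- move=> v /andP[vp _]; apply continuous_mulr.
    rewrite (_ : (fun _ => _) = fun v : R => -1 * v + v0); first exact: continuous_affine.
    by apply/funext => y; ring.
  apply: continuousV; first by rewrite gt_eqF// q0.
  rewrite (_ : (fun _ => _) = fun v : R => 1 * v + kappa / p.+3%:R); first exact: continuous_affine.
  by apply/funext => y; rewrite mul1r.
- move=> v /andP[vp _].
  have qn : v + kappa / p.+3%:R != 0 by rewrite gt_eqF// q0 ?ltW.
  have d1 : is_derive v 1 (fun v : R => - 1 * v + v0) (- 1) by exact: is_derive_affine.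
  have d2 : is_derive v 1 (fun v : R => 1 * v + kappa / p.+3%:R) 1 by exact: is_derive_affine.
  have E1 : (fun v : R => - 1 * v + v0) = (fun v : R => - (v - v0)) by apply/funext => y; ring.
  have E2 : (fun v : R => 1 * v + kappa / p.+3%:R) = (fun v : R => v + kappa / p.+3%:R).
    by apply/funext => y; rewrite mul1r.
  rewrite E1 in d1; rewrite E2 in d2.
  have d3 := is_deriveM d1 (@is_deriveV _ (fun v : R => v + kappa / p.+3%:R) v 1 1 qn d2).
  have -> : - (v0 + kappa / p.+3%:R) / (v + kappa / p.+3%:R) ^+ 2 =
    - (v - v0) *: (- (v + kappa / p.+3%:R) ^- 2 *: 1) + (v + kappa / p.+3%:R)^-1 *: (- 1).
    rewrite /GRing.scale/=; move: (kappa / _) qn => w qn.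
    by field.
  exact: d3.
- move=> x; apply: (@continuous_comp _ _ _ (fun v : R => v - v0) (fun y => y ^+ 2));
  last exact: exprn_continuous.
  rewrite (_ : (fun _ => _) = fun v : R => 1 * v - v0); first exact: continuous_affine.
  by apply/funext => y; rewrite mul1r.
- move=> v vr; have := drift p.+3%:R v kN vr.
  have -> : p.+3%:R - 1 = p.+2%:R :> R by rewrite -[p.+3]addn1 natrD addrK.
  (* The prescribed [beta] is the one that places the peak of the weight at [v0] to leading order in
     [N]. *)
  have -> // : (rho - v0)^-1 = beta * J.
  rewrite /beta -s2 sqr_spread ?(ltW aeps)//; field.
  have := spread_arg_gt0 J0 aeps; have : J != 0 by rewrite gt_eqF.
  move=> Jn; rewrite -(pmulr_lgt0 _ J0) mulrDl divfK// => h.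
  by rewrite Jn/= gt_eqF.
- move=> e /andP[ae e0].
  set d := mag J e ^+ 2.
  have sd : 0 <= rho - d by rewrite -(sqr_spread_mag J0 ae e0) sqr_ge0.
  have b1 : `|mag J e - mag J eps| <= `|d - v0| / mag J eps.
    have := sqrt_dist_le (sqr_ge0 (mag J e)) v00.
    have me0 : 0 <= mag J e by exact: sqrtr_ge0.
    by rewrite /v0 !sqrtr_sqr (ger0_norm me0) (gtr0_norm m0).
  have b2 := sqrt_dist_le sd u00.
  have E : rho - d - (rho - v0) = - (d - v0) by ring.
  rewrite E normrN in b2.
  apply: (le_trans (lerD b1 b2)); rewrite -mulrDr mulrC -/K ler_wpM2l//.
  by rewrite -[in leRHS](real_normK (num_real (d - v0))) amgm_sqrt.
Qed.

Lemma mc_expect_zero_energy (beta : R) : beta < 1 / (rho * J) ->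
  exists C : R, exists N0 : nat, forall n : nat, (N0 <= n.+1)%N ->
    forall I : 'I_k -> 'I_n.+1, injective I ->
    `| mc_expect J 0 rho (fun phi => f (proj_sites I phi))
       - c_expect J beta rho (fun phi => f (proj_sites I phi)) |
      <= C / Num.sqrt (n.+1)%:R.
Proof.
rewrite ltr_pdivlMr ?mulr_gt0// => bl.
(* [A] bounds [1 - beta * J * (rho - v)] from below on the whole range: 1 serves negative [beta],
   [1 - beta * J * rho] the others. Its positivity is the condition on [beta]. *)
pose A := Num.min 1 (1 - beta * J * rho).
have A0 : 0 < A by rewrite lt_min ltr01 subr_gt0; move: bl; rewrite mulrA mulrAC.
(* Here [C = rho], because [h = -1] turns the drift expression into
   [rho - N * v * (1 - beta * J * (rho - v))], and [K = 2], one unit for each of the two square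
   roots. *)
exists (L * 2 * (rho / A + 1)), 3 => -[//|[//|p]] _ I _.
have Np : (0 : R) < p.+3%:R by [].
apply: (@expect_dist_le beta p I 0 (fun=> -1) (fun=> 0) id) => //.
- by move=> v _; exact: cst_continuous.
- by move=> v.
- move=> v /andP[v0 vr].
  have -> : p.+2%:R = p.+3%:R - 1 :> R by rewrite -[p.+3]addn1 natrD addrK.
  have AA : A <= 1 - beta * J * (rho - v).
    rewrite /A ge_min; have [bp|bn] := leP 0 (beta * J).
      by apply/orP; right; rewrite lerD2l lerN2 ler_wpM2l// gerBl ltW.
    by apply/orP; left; rewrite lerDl oppr_ge0 nmulr_rle0// subr_ge0 ltW.
  have : p.+3%:R * v * A <= p.+3%:R * v * (1 - beta * J * (rho - v)).
    by rewrite ler_wpM2l// mulr_ge0// ltW.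
  have gen (N a : R) : N * v * a <= N * v * (1 - beta * J * (rho - v)) ->
      ((N - 1) - beta * J * N * (rho - v)) * v * -1 - (rho - v) * -1
        - 2 * (rho - v) * v * 0 <= rho - a * N * v.
    by lra.
  exact: gen.
- move=> e /andP[ae e0]; rewrite mag_end subr0 expr0n/= subr0.
  set d := mag J e; have dge : 0 <= d by exact: sqrtr_ge0.
  have sd : 0 <= rho - d ^+ 2 by rewrite -(sqr_spread_mag J0 ae e0) sqr_ge0.
  have b2 := sqrt_dist_le sd rho0.
  have sr : 0 < Num.sqrt rho by rewrite sqrtr_gt0.
  (* Since [d <= sqrt rho], the spread deviates by at most [d^2 / sqrt rho <= d], no more than the
     magnetisation itself. *)
  have b3 : `|rho - d ^+ 2 - rho| / Num.sqrt rho <= d.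
    rewrite addrAC subrr sub0r normrN ger0_norm ?sqr_ge0// ler_pdivrMr// expr2.
    rewrite ler_wpM2l// -(ger0_norm dge) -sqrtr_sqr ler_sqrt ?(ltW rho0)//.
    by rewrite -subr_ge0.
  rewrite (ger0_norm dge).
  have := amgm_sqrt Np dge; have := le_trans b2 b3.
  rewrite /=; lra.
Qed.

End mc_expectation.

Unset Implicit Arguments.

Theorem theorem4p27 (R : realType) (J rho : R) (k : nat)
    (f : k.-tuple R -> R) :
  0 < J -> 0 < rho ->
  (exists M : R, forall x, `|f x| <= M) ->
  (forall x y : k.-tuple R,
      `|f x - f y| <= norm2 [tuple tnth x i - tnth y i | i < k]) ->
  (forall eps : R, - (J * rho) / 2 < eps -> eps < 0 ->
     let beta := (1 / J) / (rho + 2 * eps / J) in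
     exists C : R, exists N0 : nat, forall n : nat, (N0 <= n.+1)%N ->
       forall I : 'I_k -> 'I_n.+1, injective I ->
       `| mc_expect J eps rho (fun phi => f (proj_sites I phi))
          - c_expect J beta rho (fun phi => f (proj_sites I phi)) |
         <= C / Num.sqrt (n.+1)%:R)
  /\
  (forall beta : R, beta < 1 / (rho * J) ->
     exists C : R, exists N0 : nat, forall n : nat, (N0 <= n.+1)%N ->
       forall I : 'I_k -> 'I_n.+1, injective I ->
       `| mc_expect J 0 rho (fun phi => f (proj_sites I phi))
          - c_expect J beta rho (fun phi => f (proj_sites I phi)) |
         <= C / Num.sqrt (n.+1)%:R).
Proof.
move=> J0 rho0 [M fM] flip; split => [eps|beta].
- exact: (mc_expect_neg_energy J0 rho0 fM flip).
- exact: (mc_expect_zero_energy J0 rho0 fM flip).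
Qed.
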